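(* Let $\mu>0$, $a>0$, $b>0$ be constants, let $\beta>4/3$ and $\gamma>1$, and let $q>2$. Let the initial data $(\rho_0,\mathbf{m}_0)$ on $\mathbb{T}^2=\mathbb{R}^2/\mathbb{Z}^2$ satisfy $$0\le \rho_0\in W^{1,q}(\mathbb{T}^2),\quad \bar\rho_0>0,\quad \mathbf{v}_0\in H^1(\mathbb{T}^2),\quad \mathbf{m}_0=\rho_0\mathbf{v}_0 ,$$ and let $(\rho,\mathbf{v})$ be the (unique) global strong solution, in the sense specified in the context, of the system $$\partial_t\rho+\operatorname{div}(\rho\mathbf{v})=0,$$ $$\partial_t(\rho\mathbf{v})+\operatorname{div}(\rho\mathbf{v}\otimes\mathbf{v})+\nabla P(\rho)=\mu\Delta\mathbf{v}+\nabla\big((\lambda(\rho)+\mu)\operatorname{div}\mathbf{v}\big)$$ on $\mathbb{T}^2\times(0,\infty)$, with $P(\rho)=a\rho^\gamma$, $\lambda(\rho)=b\rho^\beta$, and initial conditions $\rho(\cdot,0)=\rho_0$, $(\rho\mathbf{v})(\cdot,0)=\mathbf{m}_0$. Suppose that $(\rho,\mathbf{v})$ satisfies: (i) there exists a constant $C$ independent of $T$ such that $\sup_{0\le t\le T}\|\mathbf{v}(\cdot,t)\|_{H^1}\le C$ for all $0<T<\infty$; and (ii) $\lim_{t\to\infty}\big(\|\rho(\cdot,t)-\bar\rho_0\|_{L^p}+\|\nabla\mathbf{v}(\cdot,t)\|_{L^2}\big)=0$ for every $p\in[1,\infty)$. Then $$\lim_{t\to\infty}\|\mathbf{v}(\cdot,t)-\mathbf{v}_s\|_{H^1}=0,$$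 where $\mathbf{v}_s$ is the constant vector $$\mathbf{v}_s:=\frac{1}{\bar\rho_0\,|\mathbb{T}^2|}\int_{\mathbb{T}^2}\rho_0\mathbf{v}_0\,\mathrm{d}\mathbf{x}.$$
   Context: Two-dimensional barotropic compressible Navier--Stokes equations with periodic boundary conditions (period 1 in each space direction), i.e. all functions of $\mathbf{x}=(x_1,x_2)$ are defined on $\mathbb{T}^2=\mathbb{R}^2/\mathbb{Z}^2$. The unknowns are the density $\rho=\rho(\mathbf{x},t)\ge 0$ (scalar) and the velocity $\mathbf{v}=\mathbf{v}(\mathbf{x},t)\in\mathbb{R}^2$. Notation: $\bar f=\frac{1}{|\mathbb{T}^2|}\int_{\mathbb{T}^2}f\,\mathrm{d}\mathbf{x}$; $L^r=L^r(\mathbb{T}^2)$, $W^{s,r}=W^{s,r}(\mathbb{T}^2)$, $H^s=W^{s,2}$ are the standard Lebesgue and Sobolev spaces (also used for vector-valued functions). Subscript $t$ denotes the time derivative. Global strong solution: a pair $(\rho,\mathbf{v})$ such that all derivatives involved in the system are regular distributions, the equations hold almost everywhere in $\mathbb{T}^2\times(0,\infty)$, the initial conditions hold, and for every $0<T<\infty$, $$\rho\in C([0,T],W^{1,1}),\quad \rho_t\in L^\infty(0,T;L^2),$$ $$\mathbf{v}\in L^\infty(0,T;H^1)\cap L^{(q+1)/q}(0,T;W^{2,q}),$$ $$t^{1/2}\mathbf{v}\in L^2(0,T;W^{2,q}),\quad t^{1/2}\mathbf{v}_t\in L^2(0,T;H^1),$$ $$\rho\mathbf{v}\in C([0,T],L^2),\quad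 \sqrt{\rho}\,\mathbf{v}_t\in L^2(\mathbb{T}^2\times(0,T)).$$ Existence and uniqueness of such a solution under the stated assumptions on the data and on $\beta,\gamma$ is a known result (Huang and Li). *)

(* Defs.v *)
From HB Require Import structures.
From mathcomp Require Import all_boot all_order all_algebra.
From mathcomp Require Import all_classical all_reals all_analysis.

Set Implicit Arguments.
Unset Strict Implicit.
Unset Printing Implicit Defensive.
Import Order.TTheory GRing.Theory Num.Theory.
Import numFieldNormedType.Exports.

Local Open Scope classical_set_scope.
Local Open Scope ring_scope.

(* Functions on T^2 = R^2/Z^2 are represented by functions on the plane that are
   1-periodic in each variable; T^2 with its Haar measure is represented by the
   fundamental domain [cell] with the Lebesgue measure [leb2].  Measurability is
   Borel measurability: every Lebesgue class has a Borel representative, and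
   functions such as weak derivatives only matter up to null sets of [cell]. *)
Notation plane R := (R * R)%type (only parsing).

Definition torus_periodic (R : realType) (T : Type) (f : plane R -> T) : Prop :=
  forall x y, f (x + 1, y) = f (x, y) /\ f (x, y + 1) = f (x, y).

Definition cell (R : realType) : set (plane R) := `[0, 1[ `*` `[0, 1[.
Arguments cell {R}.

Notation leb1 R := (@lebesgue_measure R).

(* Restated because the library's sigma-finite instance on products is shadowed
   by its instance for subprobabilities. *)
Lemma product_sigma_finite d1 d2 (T1 : measurableType d1)
    (T2 : measurableType d2) (R : realType)
    (m1 : {sigma_finite_measure set T1 -> \bar R})
    (m2 : {sigma_finite_measure set T2 -> \bar R}) :
  sigma_finite setT (m1 \x m2)%E.
Proof.
have /sigma_finiteP[F [TF ndF Foo]] := sigma_finiteT m1.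
have /sigma_finiteP[G [TG ndG Goo]] := sigma_finiteT m2.
exists (fun n => F n `*` G n).
  rewrite -setXTT TF TG predeqE => -[x y]; split.
    move=> [/= [n _ Fnx] [k _ Gky]]; exists (maxn n k) => //; split.
    - by move: x Fnx; exact/subsetPset/ndF/leq_maxl.
    - by move: y Gky; exact/subsetPset/ndG/leq_maxr.
  by move=> [n _ []/= ? ?]; split; exists n.
move=> k; have [? ?] := Foo k; have [? ?] := Goo k.
split; first exact: measurableX.
by rewrite product_measure1E// lte_mul_pinfty// ge0_fin_numE.
Qed.

Definition leb2 (R : realType) :
    set (measurableTypeR R * measurableTypeR R)%type -> \bar R :=
  (leb1 R \x leb1 R)%E.
Arguments leb2 R : clear implicits.
HB.instance Definition _ (R : realType) := Measure.on (leb2 R).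
HB.instance Definition _ (R : realType) :=
  Measure_isSigmaFinite.Build _ _ _ (leb2 R)
    (product_sigma_finite (leb1 R) (leb1 R)).

Definition leb3 (R : realType) :
    set (measurableTypeR R * (measurableTypeR R * measurableTypeR R))%type ->
    \bar R :=
  (leb1 R \x leb2 R)%E.
Arguments leb3 R : clear implicits.
HB.instance Definition _ (R : realType) := Measure.on (leb3 R).
HB.instance Definition _ (R : realType) :=
  Measure_isSigmaFinite.Build _ _ _ (leb3 R)
    (product_sigma_finite (leb1 R) (leb2 R)).

Definition torus_area (R : realType) : R := fine (leb2 R cell).

Definition torus_int (R : realType) (f : plane R -> R) : R :=
  \int[leb2 R]_(x in cell) f x.

Definition mean (R : realType) (f : plane R -> R) : R :=
  (torus_area R)^-1 * torus_int f.

Definition iter_derive (R : realType) (E : normedModType R) (s : seq E)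
  (phi : E -> R) : E -> R := foldr (fun e g => 'D_e g) phi s.

(* On a finite-dimensional space this means of class C^oo. *)
Definition smooth (R : realType) (E : normedModType R) (phi : E -> R) : Prop :=
  forall (s : seq E) (z : E), differentiable (iter_derive s phi) z.

(** Lebesgue and Sobolev norms on T^2; the value is +oo outside the space *)

Definition Lr_norm (R : realType) (r : \bar R) (f : plane R -> R) : \bar R :=
  if `[< measurable_fun cell f >] then ('N[leb2 R]_r[EFin \o (f \_ cell)%R])%E
  else +oo%E.

Definition basis2 (R : realType) (j : 'I_2) : plane R :=
  if j == ord0 then (1, 0) else (0, 1).

Definition multi_dirs (R : realType) (alpha : nat * nat) : seq (plane R) :=
  nseq alpha.1 (basis2 R ord0) ++ nseq alpha.2 (basis2 R ord_max).

Definition weak_partial (R : realType) (alpha : nat * nat)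
    (f g : plane R -> R) : Prop :=
  [/\ (leb2 R).-integrable cell (EFin \o f),
      (leb2 R).-integrable cell (EFin \o g) &
      forall phi : plane R -> R, smooth phi -> torus_periodic phi ->
        torus_int (fun x => f x * iter_derive (multi_dirs R alpha) phi x) =
        (-1) ^+ (alpha.1 + alpha.2) * torus_int (fun x => g x * phi x)].

(* || D^alpha f ||_{L^r}; any two weak derivatives agree a.e. in [cell] *)
Definition partial_norm (R : realType) (r : \bar R) (alpha : nat * nat)
    (f : plane R -> R) : \bar R :=
  if `[< exists g, weak_partial alpha f g >]
  then Lr_norm r (get [set g | weak_partial alpha f g]) else +oo%E.

Definition sobolev_norm (R : realType) (k : nat) (r : R) (f : plane R -> R) :
    \bar R :=
  ((\sum_(alpha : 'I_k.+1 * 'I_k.+1 | (alpha.1 + alpha.2 <= k)%N)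
      partial_norm r%:E (alpha.1 : nat, alpha.2 : nat) f `^ r) `^ r^-1)%E.

Definition vect_norm (R : realType) (r : R) (N : (plane R -> R) -> \bar R)
    (u : 'I_2 -> plane R -> R) : \bar R :=
  ((\sum_(i < 2) N (u i) `^ r) `^ r^-1)%E.

Definition H1_norm (R : realType) (u : 'I_2 -> plane R -> R) : \bar R :=
  vect_norm 2 (sobolev_norm 1 2) u.

Definition grad_L2_norm (R : realType) (u : 'I_2 -> plane R -> R) : \bar R :=
  ((\sum_(i < 2) (partial_norm 2%:E (1%N, 0%N) (u i) `^ 2 +
                  partial_norm 2%:E (0%N, 1%N) (u i) `^ 2)) `^ 2^-1)%E.

(** Spaces of functions of time with values in X = {u : V | N u < +oo} *)

Definition strongly_measurable (R : realType) (V : lmodType R)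
    (N : V -> \bar R) (T : R) (f : R -> V) : Prop :=
  exists s : nat -> R -> V,
    (forall n, exists (m : nat) (A : 'I_m -> set (measurableTypeR R))
                      (c : 'I_m -> V),
       [/\ forall k, measurable (A k), forall k, (N (c k) < +oo)%E &
           forall t, s n t = \sum_(k < m) \1_(A k) t *: c k]) /\
    {ae leb1 R, forall t, 0 < t < T -> N (f t - s n t) @[n --> \oo] --> 0%E}.

(* f \in L^p(0, T; X) *)
Definition bochner (R : realType) (V : lmodType R) (p : \bar R) (T : R)
    (N : V -> \bar R) (f : R -> V) : Prop :=
  strongly_measurable N T f /\
  ('N[leb1 R]_p[(fun t => N (f t)) \_ `]0%R, T[] < +oo)%E.

(* f \in C([0, T], X) *)
Definition cont_in_time (R : realType) (V : lmodType R) (T : R)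
    (N : V -> \bar R) (f : R -> V) : Prop :=
  forall t, 0 <= t <= T -> (N (f t) < +oo)%E /\
    N (f s - f t) @[s --> within `[0, T] (nbhs t)] --> 0%E.

(** Distributions on T^2 x (0, +oo); points are pairs (time, position) *)

Definition dt (R : realType) : R * plane R := (1, (0, 0)).
Definition dx (R : realType) (j : 'I_2) : R * plane R := (0, basis2 R j).
Arguments dt {R}.
Arguments dx {R}.

Definition st_test (R : realType) (phi : R * plane R -> R) : Prop :=
  [/\ smooth phi, forall t, torus_periodic (fun x => phi (t, x)) &
      exists s T : R, [/\ 0 < s, s < T &
        forall t x, ~~ (s <= t <= T) -> phi (t, x) = 0]].

Definition st_loc_integrable (R : realType) (f : R -> plane R -> R) : Prop :=
  forall s T : R, 0 < s -> s < T ->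
    (leb3 R).-integrable (`[s, T] `*` cell) (fun z => (f z.1 z.2)%:E).

Definition st_int (R : realType) (h : R * plane R -> R) : R :=
  \int[leb3 R]_(z in `]0, +oo[ `*` cell) h z.

Definition st_weak_derive (R : realType) (s : seq (R * plane R))
    (f g : R -> plane R -> R) : Prop :=
  [/\ st_loc_integrable f, st_loc_integrable g &
      forall phi, st_test phi ->
        st_int (fun z => f z.1 z.2 * iter_derive s phi z) =
        (-1) ^+ size s * st_int (fun z => g z.1 z.2 * phi z)].

Definition regular (R : realType) (s : seq (R * plane R))
    (f : R -> plane R -> R) : Prop :=
  exists g, st_weak_derive s f g.

(* the function representing the distributional derivative, when [regular s f] *)
Definition wD (R : realType) (s : seq (R * plane R)) (f : R -> plane R -> R) :
    R -> plane R -> R :=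
  get [set g | st_weak_derive s f g].

Definition st_ae (R : realType) (P : R -> plane R -> Prop) : Prop :=
  {ae leb3 R, forall z, (`]0, +oo[ `*` cell) z -> P z.1 z.2}.

Definition torus_ae (R : realType) (P : plane R -> Prop) : Prop :=
  {ae leb2 R, forall x, cell x -> P x}.

(* f \in L^2(T^2 x (0, T)) *)
Definition st_L2 (R : realType) (T : R) (f : R -> plane R -> R) : Prop :=
  let D := (`]0, T[ `*` cell) : set (R * plane R) in
  measurable_fun D (fun z => f z.1 z.2) /\
  ('N[leb3 R]_2%:E[EFin \o ((fun z => f z.1 z.2) \_ D)%R] < +oo)%E.

Definition pressure (R : realType) (a gamma : R) (rho : R) : R :=
  a * rho `^ gamma.
Definition viscosity (R : realType) (b beta : R) (rho : R) : R :=
  b * rho `^ beta.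

Definition component (R : realType) (v : R -> 'I_2 -> plane R -> R) (i : 'I_2) :
  R -> plane R -> R := fun t x => v t i x.

Definition divergence (R : realType) (v : R -> 'I_2 -> plane R -> R) :
  R -> plane R -> R := fun t x => \sum_(j < 2) wD [:: dx j] (component v j) t x.

(* rho v_i, rho v_i v_j, P(rho) and (lambda(rho) + mu) div v *)
Definition momentum (R : realType) (rho : R -> plane R -> R)
  (v : R -> 'I_2 -> plane R -> R) (t : R) (i : 'I_2) (x : plane R) : R :=
  rho t x * v t i x.
Definition mom_flux (R : realType) (rho : R -> plane R -> R)
  (v : R -> 'I_2 -> plane R -> R) (i j : 'I_2) (t : R) (x : plane R) : R :=
  rho t x * v t i x * v t j x.
Definition press (R : realType) (a gamma : R) (rho : R -> plane R -> R)
  (t : R) (x : plane R) : R := pressure a gamma (rho t x).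
Definition bulk (R : realType) (mu b beta : R) (rho : R -> plane R -> R)
  (v : R -> 'I_2 -> plane R -> R) (t : R) (x : plane R) : R :=
  (viscosity b beta (rho t x) + mu) * divergence v t x.

Definition derivatives_regular (R : realType) (mu a b beta gamma : R)
    (rho : R -> plane R -> R) (v : R -> 'I_2 -> plane R -> R) : Prop :=
  [/\ regular [:: dt] rho,
      regular [:: dt] (component v ord0) /\ regular [:: dt] (component v ord_max),
      forall i, regular [:: dt] (component (momentum rho v) i) /\
                regular [:: dx i] (component (momentum rho v) i),
      forall i j, [/\ regular [:: dx j] (mom_flux rho v i j),
                      regular [:: dx j] (component v i) &
                      regular [:: dx j; dx j] (component v i)] &
      forall i, regular [:: dx i] (press a gamma rho) /\
                regular [:: dx i] (bulk mu b beta rho v)].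

Definition continuity_equation (R : realType)
    (rho : R -> plane R -> R) (v : R -> 'I_2 -> plane R -> R) : Prop :=
  st_ae (fun t x =>
    wD [:: dt] rho t x + \sum_(j < 2) wD [:: dx j] (component (momentum rho v) j) t x
    = 0).

Definition momentum_equation (R : realType) (mu a b beta gamma : R)
    (rho : R -> plane R -> R) (v : R -> 'I_2 -> plane R -> R) : Prop :=
  forall i, st_ae (fun t x =>
    wD [:: dt] (component (momentum rho v) i) t x
    + \sum_(j < 2) wD [:: dx j] (mom_flux rho v i j) t x
    + wD [:: dx i] (press a gamma rho) t x
    = mu * (\sum_(j < 2) wD [:: dx j; dx j] (component v i) t x)
      + wD [:: dx i] (bulk mu b beta rho v) t x).

Definition time_deriv (R : realType) (v : R -> 'I_2 -> plane R -> R)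
  (t : R) (i : 'I_2) (x : plane R) : R := wD [:: dt] (component v i) t x.

Definition strong_regularity (R : realType) (q T : R)
    (rho : R -> plane R -> R) (v : R -> 'I_2 -> plane R -> R) : Prop :=
  [/\ cont_in_time T (sobolev_norm 1 1) rho,
      bochner +oo%E T (Lr_norm 2%:E) (wD [:: dt] rho),
      bochner +oo%E T (@H1_norm R) v /\
      bochner ((q + 1) / q)%:E T (vect_norm q (sobolev_norm 2 q)) v,
      bochner 2%:E T (vect_norm q (sobolev_norm 2 q))
        (fun t i x => Num.sqrt t * v t i x) /\
      bochner 2%:E T (@H1_norm R)
        (fun t i x => Num.sqrt t * time_deriv v t i x) &
      cont_in_time T (vect_norm 2 (Lr_norm 2%:E)) (momentum rho v) /\
      forall i, st_L2 T (fun t x => Num.sqrt (rho t x) * time_deriv v t i x)].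

(* The values of rho and v at negative times are irrelevant. *)
Record global_strong_solution (R : realType) (mu a b beta gamma q : R)
    (rho0 : plane R -> R) (m0 : 'I_2 -> plane R -> R)
    (rho : R -> plane R -> R) (v : R -> 'I_2 -> plane R -> R) : Prop := {
  gss_periodic_rho : forall t, 0 <= t -> torus_periodic (rho t) ;
  gss_periodic_v : forall t i, 0 <= t -> torus_periodic (v t i) ;
  gss_nonneg : forall t, 0 <= t -> torus_ae (fun x => 0 <= rho t x) ;
  gss_derivatives : derivatives_regular mu a b beta gamma rho v ;
  gss_continuity : continuity_equation rho v ;
  gss_momentum : momentum_equation mu a b beta gamma rho v ;
  gss_init_rho : torus_ae (fun x => rho 0 x = rho0 x) ;
  gss_init_mom : forall i, torus_ae (fun x => momentum rho v 0 i x = m0 i x) ;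
  gss_regularity : forall T, 0 < T -> strong_regularity q T rho v }.

(* Main.v *)
(* By the weak momentum equation tested against functions of time only, the
   total momentum [\int rho v] is constant in time, so that
     mean rho0 * (mean v - vs) = - \int (rho - mean rho0) v,
   which tends to 0 because rho - mean rho0 -> 0 in L^2 and v is bounded in L^2.
   The Poincare inequality ||v - mean v|| <= C ||grad v|| and grad v -> 0 in L^2
   give the rest.

   The Poincare inequality is proved by duality from the definition of weak
   derivatives.  With kern x s = (s < x) - x, a 1-periodic function a with mean
   m(a) satisfies a - m(a) = A' for the periodic function
   A x = \int kern x s * a s ds.  Testing with A(x) b(y) and m(a) B(y) and using
   Fubini's theorem shows that
     f - mean f + \int kern x s * (d1 f)(x, y) dx
                + \int\int kern y' y * (d2 f)(x', y') dx' dy'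
   is orthogonal to all tensor products a(x) b(y), hence vanishes a.e. *)
From HB Require Import structures.
Require Import Defs.
From mathcomp Require Import all_boot all_order all_algebra.
From mathcomp Require Import all_classical all_reals all_analysis.
From mathcomp Require Import measurable_realfun.
From mathcomp Require Import ring lra.
Import Order.TTheory GRing.Theory Num.Theory.
Import numFieldNormedType.Exports.
Local Open Scope classical_set_scope.
Local Open Scope ring_scope.
Set Implicit Arguments.
Unset Strict Implicit.
Unset Printing Implicit Defensive.

(** * Smooth functions of one variable and smooth steps *)

(** Weak derivatives are accessible only through integrals against smooth periodic functions, and no
    approximation of $f$ by smooth functions is made. The Poincare inequality therefore rests on the
    choice of test functions, which must be exactly smooth and exactly periodic. Tensor products
    suffice: smooth steps of a periodic function converge on the cell to indicators of quadrants,
    and a Dynkin argument passes from quadrants to all Borel sets. The smooth step built for this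
    from exp(-1/x) serves again for the momentum: the difference of two ramps in time localises the
    weak equation near two instants. Distributional derivatives are integrable only on slabs away
    from t = 0, so the total momentum is first shown constant at positive times and then joined to
    the initial data by continuity of [momentum] in L^2. Norms are extended reals and weak
    derivatives are picked by choice; hence estimates are made on squares, where components add up,
    and representatives are compared almost everywhere. *)

Section smooth_functions_of_one_variable.
Context {R : realType}.
Implicit Types (f g : R -> R) (n k : nat) (x : R).

(** Asking for some derivative function, rather than speaking of iterated [derive1], makes closure
    under sums, products and composition an induction on [n] in which the derivative is simply
    exhibited. *)
Fixpoint Cn n f : Prop := if n isn't n'.+1 then True else
  exists2 f', forall x, is_derive x (1 : R) f (f' x) & Cn n' f'.

Definition Cinf f : Prop := forall n, Cn n f.

Lemma CnS n f : Cn n.+1 f -> Cn n f.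
Proof.
elim: n f => [//|n ih] f [f' df cf'].
by exists f' => //; exact: ih.
Qed.

Lemma Cn_cst n (c : R) : Cn n (cst c).
Proof.
elim: n c => [//|n ih] c.
by exists (cst 0) => // x; exact: is_derive_cst.
Qed.

Lemma CnD n f g : Cn n f -> Cn n g -> Cn n (f \+ g).
Proof.
elim: n f g => [//|n ih] f g [f' df cf] [g' dg cg].
by exists (f' \+ g'); [move=> x; exact: is_deriveD|exact: ih].
Qed.

Lemma CnM n f g : Cn n f -> Cn n g -> Cn n (f \* g).
Proof.
elim: n f g => [//|n ih] f g cf cg.
have cfn := CnS cf; have cgn := CnS cg.
case: cf => f' df cf; case: cg => g' dg cg.
exists ((f \* g') \+ (g \* f')); first by move=> x; exact: is_deriveM.
by apply: CnD; apply: ih.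
Qed.

Lemma CnZ n (c : R) f : Cn n f -> Cn n (fun x => c * f x).
Proof. by move=> cf; apply: (@CnM n (cst c) f) => //; exact: Cn_cst. Qed.

Lemma Cn_id n : Cn n (@id R).
Proof.
case: n => [//|n]; exists (cst 1); last exact: Cn_cst.
by move=> x; exact: is_derive_id.
Qed.

Lemma Cn_comp n f g : Cn n f -> Cn n g -> Cn n (g \o f).
Proof.
elim: n f g => [//|n ih] f g cf cg.
have cfn := CnS cf.
case: cf => f' df cf; case: cg => g' dg cg.
exists ((g' \o f) \* f'); last by apply: CnM => //; exact: ih.
by move=> x; exact: is_derive1_comp.
Qed.

Lemma Cinf_derive f : Cinf f ->
  (forall x, is_derive x (1 : R) f (f^`()%classic x)) /\ Cinf f^`()%classic.
Proof.
move=> cf.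
have df x : is_derive x (1 : R) f (f^`()%classic x).
  have [f' df _] := cf 1%N.
  rewrite derive1E; apply: derivableP; by case: (df x).
split => // n; have [f' df' cf'] := cf n.+1.
suff -> : f^`()%classic = f' by [].
by apply/funext => x; rewrite derive1E; exact: derive_val.
Qed.

Lemma Cinf_is_derive f x : Cinf f -> is_derive x (1 : R) f (f^`()%classic x).
Proof. by move=> /Cinf_derive[]. Qed.

Lemma Cinf_derive1 f : Cinf f -> Cinf f^`()%classic.
Proof. by move=> /Cinf_derive[]. Qed.

Lemma Cinf_of_derive f g : (forall x, is_derive x (1 : R) f (g x)) ->
  Cinf g -> Cinf f.
Proof. by move=> df cg [//|n]; exists g. Qed.

Lemma Cinf_cst (c : R) : Cinf (cst c). Proof. by move=> n; exact: Cn_cst. Qed.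

Lemma Cinf_id : Cinf (@id R). Proof. by move=> n; exact: Cn_id. Qed.

Lemma CinfD f g : Cinf f -> Cinf g -> Cinf (f \+ g).
Proof. by move=> cf cg n; exact: CnD. Qed.

Lemma CinfM f g : Cinf f -> Cinf g -> Cinf (f \* g).
Proof. by move=> cf cg n; exact: CnM. Qed.

Lemma CinfZ (c : R) f : Cinf f -> Cinf (fun x => c * f x).
Proof. by move=> cf n; exact: CnZ. Qed.

Lemma CinfB f g : Cinf f -> Cinf g -> Cinf (f \- g).
Proof.
move=> cf cg; rewrite (_ : f \- g = f \+ (fun x => (-1) * g x)).
  by apply: CinfD => //; exact: CinfZ.
by apply/funext => x /=; rewrite mulN1r.
Qed.

Lemma Cinf_comp f g : Cinf f -> Cinf g -> Cinf (g \o f).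
Proof. by move=> cf cg n; exact: Cn_comp. Qed.

Lemma Cinf_affine f (a b : R) : Cinf f -> Cinf (fun x => f (a * x + b)).
Proof.
move=> cf; apply: (@Cinf_comp (fun x => a * x + b)) => //.
by apply: (@CinfD (fun x => a * x)) (Cinf_cst b); apply/CinfZ/Cinf_id.
Qed.

Lemma Cinf_continuous f : Cinf f -> continuous f.
Proof.
move=> cf x; apply/differentiable_continuous/derivable1_diffP.
by case: (Cinf_is_derive x cf).
Qed.

Lemma Cinf_measurable f : Cinf f -> measurable_fun setT f.
Proof. by move=> /Cinf_continuous; exact: continuous_measurable_fun. Qed.

Lemma Cinf_sin : Cinf (@sin R) /\ Cinf (@cos R).
Proof.
suff h n : Cn n (@sin R) /\ Cn n (@cos R).
  by split=> n; [exact: (h n).1|exact: (h n).2].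
elim: n => [//|n [hs hc]]; split; first by exists (@cos R) => // x; exact: is_derive_sin.
exists (fun x => - sin x) => [x|]; first exact: is_derive_cos.
rewrite (_ : (fun x => - sin x) = fun x => -1 * sin x); first exact: CnZ.
by apply/funext => x; rewrite mulN1r.
Qed.

(* The functions vanishing on the nonpositive axis that arise as derivatives of
   exp(-1/x): their span is stable under derivation. *)
Definition flat k x : R := if 0 < x then x ^- k * expR (- x^-1) else 0.

Lemma flat_ge0 k x : 0 <= flat k x.
Proof.
rewrite /flat; case: ifPn => // x0.
by rewrite mulr_ge0 ?expR_ge0// invr_ge0 exprn_ge0// ltW.
Qed.

(** A single term of the exponential series, y^(k+1)/(k+1)! <= exp y at y = 1/x, beats the pole.
    This linear bound gives differentiability at the origin. *)
Lemma flat_le k x : 0 < x -> flat k x <= (k.+1)`!%:R * x.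
Proof.
move=> x0; rewrite /flat x0 expRN.
rewrite ler_pdivrMr ?expR_gt0//.
have xV : 0 <= x^-1 by rewrite invr_ge0 ltW.
have h : x^-1 ^+ k.+1 <= (k.+1)`!%:R * expR x^-1.
  rewrite mulrC -ler_pdivrMr ?ltr0n ?fact_gt0//.
  by apply: le_trans (expR_ge1Dxn k xV); rewrite lerDr.
rewrite mulrAC mulrC -ler_pdivrMl// -exprVn -exprS.
exact: h.
Qed.

Lemma flat_derive k x :
  is_derive x (1 : R) (flat k) (flat k.+2 x - k%:R * flat k.+1 x).
Proof.
have [x0|x0|<-] := ltgtP 0 x.
- apply: (@near_eq_is_derive R R R (fun y => y^-1 ^+ k * expR (- y^-1))).
    near=> y; rewrite /flat; have -> : 0 < y by near: y; exact: lt_nbhsr.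
    by rewrite exprVn.
  have dV : is_derive x (1 : R) (@GRing.inv R) (- x ^- 2).
    rewrite (_ : - x ^- 2 = - x ^- 2 *: (1 : R)); last by rewrite scaler1.
    apply: (@is_deriveV _ id).
    by rewrite gt_eqF.
  have de : is_derive x (1 : R) (fun y => expR (- y^-1))
      (expR (- x^-1) * (- - x ^- 2)).
    by apply: (@is_derive1_comp _ expR (fun y => - y^-1)).
  have dX : is_derive x (1 : R) (fun y => y^-1 ^+ k)
      (k%:R * x^-1 ^+ k.-1 * (- x ^- 2)).
    rewrite (_ : (fun y => y^-1 ^+ k) = (@GRing.inv R) ^+ k); first exact: is_deriveX.
    by apply/funext => y; rewrite exprfctE.
  apply: (is_derive_eq (is_deriveM dX de)).
  rewrite /flat x0 /GRing.scale/=.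
  have xn0 : x != 0 by rewrite gt_eqF.
  rewrite !opprK.
  case: k {dX} => [|k]; first by rewrite !mul0r !expr0 mulr0 subr0 addr0; ring.
  rewrite /= -!exprVn !exprS; ring.
- apply: (@near_eq_is_derive R R R (cst 0)).
    near=> y; rewrite /flat ifF//; apply/negbTE; rewrite -leNgt ltW//.
    by near: y; exact: lt_nbhsl.
  rewrite /flat !ifF ?mulr0 ?subr0; try by apply/negbTE; rewrite -leNgt ltW.
  exact: is_derive_cst.
- have e0 j : flat j 0 = 0 by rewrite /flat ltxx.
  rewrite !e0 mulr0 subr0.
  (* At the origin the difference quotient is 0 on the left and [flat k.+1 h] on the right, which
     [flat_le] sends to 0. *)
  have lim0 : h^-1 *: (flat k (h *: 1 + 0) - flat k 0) @[h --> 0^'] --> (0 : R).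
    apply/cvgrPdist_le => e e0'.
    have c0 : 0 < (k.+2)`!%:R :> R by rewrite ltr0n fact_gt0.
    near=> h.
    have hn0 : h != 0 by near: h; exact: nbhs_dnbhs_neq.
    rewrite e0 subr0 sub0r normrN addr0 /GRing.scale/= mulr1.
    have he : `|h| < e / (k.+2)`!%:R.
      near: h; apply: dnbhs0_lt; exact: divr_gt0.
    have [h0|h0] := ltP 0 h; last by rewrite /flat ifF ?mulr0 ?normr0 ?ltW// ltNge h0.
    have -> : h^-1 * flat k h = flat k.+1 h.
      by rewrite /flat h0 mulrA -!exprVn exprS.
    rewrite ger0_norm ?flat_ge0// (le_trans (flat_le _ h0))//.
    rewrite mulrC -ler_pdivlMr// ltW//.
    by rewrite (le_lt_trans _ he)// ler_norm.
  apply: DeriveDef; last exact: cvg_lim lim0.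
  by apply/cvg_ex; exists 0.
Unshelve. all: by end_near. Qed.

Lemma Cinf_flat k : Cinf (flat k).
Proof.
move=> n; elim: n k => [//|n ih] k.
exists (flat k.+2 \- (fun x => k%:R * flat k.+1 x)).
  by move=> x; exact: flat_derive.
rewrite (_ : _ \- _ = flat k.+2 \+ (fun x => (- k%:R) * flat k.+1 x)).
  by apply: CnD => //; exact: CnZ.
by apply/funext => x /=; rewrite mulNr.
Qed.

Lemma flat0E x : 0 < x -> flat 0 x = expR (- x^-1).
Proof. by rewrite /flat => ->; rewrite expr0 invr1 mul1r. Qed.

Lemma flat0_nd : {homo flat 0 : x y / x <= y}.
Proof.
move=> x y xy; have [x0|x0] := ltP 0 x; last first.
  by rewrite {1}/flat ifF ?flat_ge0// ltNge x0.
by rewrite !flat0E ?(lt_le_trans x0)// ler_expR lerN2 lef_pV2// ?posrE (lt_le_trans x0).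
Qed.

(** The inner difference is nondecreasing, nonpositive for x <= 0 and constant for x >= 1; the outer
    [flat 0] cuts off its negative values. As a composition of monotone functions the step is
    monotone without any computation of derivatives. *)
Definition step x : R := flat 0 (flat 0 1 - flat 0 (1 - x)) / flat 0 (flat 0 1).

Lemma flat01_gt0 : 0 < flat 0 (flat 0 1).
Proof. by rewrite flat0E ?expR_gt0// flat0E// expR_gt0. Qed.

Lemma step_nd : {homo step : x y / x <= y}.
Proof.
move=> x y xy; rewrite ler_pM2r ?invr_gt0 ?flat01_gt0//; apply: flat0_nd.
by rewrite lerD2l lerN2; apply: flat0_nd; rewrite lerD2l lerN2.
Qed.

Lemma step_le0 x : x <= 0 -> step x = 0.
Proof.
move=> x0; rewrite /step {1}/flat ifF ?mul0r//.
apply/negbTE; rewrite -leNgt subr_le0; apply: flat0_nd; lra.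
Qed.

Lemma step_ge1 x : 1 <= x -> step x = 1.
Proof.
move=> x1; rewrite /step (_ : flat 0 (1 - x) = 0).
  by rewrite subr0 divff// gt_eqF// flat01_gt0.
by rewrite /flat ifF//; apply/negbTE; rewrite -leNgt; lra.
Qed.

Lemma step_ge0 x : 0 <= step x.
Proof. by rewrite divr_ge0// flat_ge0. Qed.

Lemma step_le1 x : step x <= 1.
Proof.
by have [x1|/ltW x1] := leP 1 x; [rewrite step_ge1|rewrite -(step_ge1 (lexx 1)) step_nd].
Qed.

Lemma Cinf_step : Cinf step.
Proof.
have c1 : Cinf (fun x => flat 0 (1 - x)).
  rewrite (_ : (fun x => _) = (fun x => flat 0 ((-1) * x + 1))).
    exact/Cinf_affine/Cinf_flat.
  by apply/funext => x; rewrite mulN1r addrC.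
have c2 : Cinf (fun x => flat 0 1 - flat 0 (1 - x)).
  by apply: (CinfB (Cinf_cst (flat 0 1))).
rewrite (_ : step = fun x => (flat 0 (flat 0 1))^-1 * flat 0 (flat 0 1 - flat 0 (1 - x))).
  by apply: CinfZ; apply: (Cinf_comp c2); exact: Cinf_flat.
by apply/funext => x; rewrite /step mulrC.
Qed.

End smooth_functions_of_one_variable.

(** * Smooth test functions on products: tensor products and functions of one factor *)

Section smooth_test_functions.
Context {R : realType}.

(** Smoothness by invariance: it is enough to exhibit a class of differentiable functions stable
    under every directional derivative, with no formula for the iterated ones. *)
Lemma smooth_closed (E : normedModType R) (P : (E -> R) -> Prop) :
  (forall phi, P phi -> (forall z, differentiable phi z) /\
     forall e, P ('D_e phi)) ->
  forall phi, P phi -> smooth phi.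
Proof.
move=> hP phi Pphi s z; suff : P (iter_derive s phi) by move=> /hP[].
by elim: s => [//|e s ih]; exact: (hP _ ih).2.
Qed.

Lemma differentiable_Cinf (a : R -> R) (x : R) : Cinf a -> differentiable a x.
Proof. by move=> /(Cinf_is_derive x)[] /derivable1_diffP. Qed.

Lemma diff_Cinf (a : R -> R) (x h : R) : Cinf a ->
  'd a x h = h * a^`()%classic x.
Proof. by move=> /(differentiable_Cinf x)/diff1E ->. Qed.

Lemma is_diff_fst (V W : normedModType R) (z : V * W) : is_diff z fst fst.
Proof.
have lin : linear (@fst V W) by [].
pose L := GRing.isLinear.Build _ _ _ _ _ lin.
pose F : {linear (V * W)%type -> V} := HB.pack (@fst V W) L.
have cF : continuous F by move=> p; exact: cvg_fst.
by apply: DiffDef; [exact: (@linear_differentiable _ _ _ F)|exact: (@diff_lin _ _ _ F)].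
Qed.

Lemma is_diff_snd (V W : normedModType R) (z : V * W) : is_diff z snd snd.
Proof.
have lin : linear (@snd V W) by [].
pose L := GRing.isLinear.Build _ _ _ _ _ lin.
pose F : {linear (V * W)%type -> W} := HB.pack (@snd V W) L.
have cF : continuous F by move=> p; exact: cvg_snd.
by apply: DiffDef; [exact: (@linear_differentiable _ _ _ F)|exact: (@diff_lin _ _ _ F)].
Qed.

Local Existing Instance is_diff_fst.
Local Existing Instance is_diff_snd.

Lemma diff_fst_comp (W : normedModType R) (a : R -> R) (z e : R * W) :
  Cinf a -> 'D_e (a \o fst) z = e.1 * a^`()%classic z.1.
Proof.
move=> ca; rewrite deriveE; last first.
  by apply: differentiable_comp => //; exact: differentiable_Cinf.
rewrite diff_comp//; last exact: differentiable_Cinf.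
by rewrite /= diff_Cinf// diff_val.
Qed.

Lemma diff_snd_comp (V : normedModType R) (a : R -> R) (z e : V * R) :
  Cinf a -> 'D_e (a \o snd) z = e.2 * a^`()%classic z.2.
Proof.
move=> ca; rewrite deriveE; last first.
  by apply: differentiable_comp => //; exact: differentiable_Cinf.
rewrite diff_comp//; last exact: differentiable_Cinf.
by rewrite /= diff_Cinf// diff_val.
Qed.

Definition tensor (a b : R -> R) : R * R -> R := (a \o fst) * (b \o snd).

Lemma tensorE a b z : tensor a b z = a z.1 * b z.2.
Proof. by []. Qed.

Lemma differentiable_tensor (a b : R -> R) z :
  Cinf a -> Cinf b -> differentiable (tensor a b) z.
Proof.
move=> ca cb; apply: differentiableM; apply: differentiable_comp => //;
  exact: differentiable_Cinf.
Qed.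

Lemma derive_tensor (a b : R -> R) (z e : R * R) : Cinf a -> Cinf b ->
  'D_e (tensor a b) z =
  e.1 * (a^`()%classic z.1 * b z.2) + e.2 * (a z.1 * b^`()%classic z.2).
Proof.
move=> ca cb; rewrite deriveM; last 2 first.
- by apply/diff_derivable/differentiable_comp => //; exact: differentiable_Cinf.
- by apply/diff_derivable/differentiable_comp => //; exact: differentiable_Cinf.
rewrite diff_fst_comp// diff_snd_comp// /GRing.scale/=; ring.
Qed.

(** A directional derivative of a tensor product has two terms, so the invariant class for
    [smooth_closed] must contain finite sums. *)
Inductive tensor_sum : (R * R -> R) -> Prop :=
| tensor_sum_tensor a b : Cinf a -> Cinf b -> tensor_sum (tensor a b)
| tensor_sumD f g : tensor_sum f -> tensor_sum g -> tensor_sum (f + g).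

Lemma smooth_tensor (a b : R -> R) : Cinf a -> Cinf b -> smooth (tensor a b).
Proof.
move=> ca cb; apply: (@smooth_closed _ tensor_sum); last exact: tensor_sum_tensor.
move=> phi; elim=> {a b ca cb} [a b ca cb|f g sf [df Df] sg [dg Dg]].
  split=> [z|e]; first exact: differentiable_tensor.
  rewrite (_ : 'D_e _ = tensor (fun x => e.1 * a^`()%classic x) b +
                        tensor a (fun x => e.2 * b^`()%classic x)).
    by apply: tensor_sumD; apply: tensor_sum_tensor => //; apply: CinfZ;
      exact: Cinf_derive1.
  apply/funext => z; rewrite derive_tensor// addrfctE !tensorE; ring.
split=> [z|e]; first exact: differentiableD.
rewrite (_ : 'D_e _ = 'D_e f + 'D_e g); first exact: tensor_sumD.
by apply/funext => z; rewrite deriveD//; exact: diff_derivable.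
Qed.

Lemma smooth_fst (W : normedModType R) (a : R -> R) : Cinf a ->
  smooth (a \o fst : R * W -> R).
Proof.
move=> ca; apply: (@smooth_closed _
  (fun phi : R * W -> R => exists2 b : R -> R, Cinf b & phi = b \o fst)); last by exists a.
move=> _ [b cb ->]; split=> [z|e].
  by apply: differentiable_comp => //; exact: differentiable_Cinf.
exists (fun t => e.1 * b^`()%classic t); first exact/CinfZ/Cinf_derive1.
by apply/funext => z; rewrite diff_fst_comp.
Qed.

Lemma smooth_derive (E : normedModType R) (phi : E -> R) (e : E) :
  smooth phi -> smooth ('D_e phi).
Proof.
move=> sphi s z; have := sphi (s ++ [:: e]) z.
by rewrite /iter_derive foldr_cat.
Qed.

Lemma smooth_continuous (E : normedModType R) (phi : E -> R) :
  smooth phi -> continuous phi.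
Proof. by move=> sphi z; exact: differentiable_continuous (sphi [::] z). Qed.

Definition periodic1 (a : R -> R) := forall x, a (x + 1) = a x.

(** The smooth periodic functions of one variable, that is, the factors of the tensor test functions
    on the torus. *)
Definition SP (a : R -> R) := Cinf a /\ periodic1 a.

Lemma SP_cst (c : R) : SP (cst c).
Proof. by split => //; exact: Cinf_cst. Qed.

Lemma torus_periodic_tensor (a b : R -> R) :
  periodic1 a -> periodic1 b -> torus_periodic (tensor a b).
Proof.
move=> pa pb x y; by rewrite !tensorE /= pa pb.
Qed.

End smooth_test_functions.

(** * Integration on rectangles *)

Section fubini_on_rectangles.
Context d1 d2 (T1 : measurableType d1) (T2 : measurableType d2) (R : realType).
Variables (m1 : {sigma_finite_measure set T1 -> \bar R})
          (m2 : {sigma_finite_measure set T2 -> \bar R}).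
Variables (D1 : set T1) (D2 : set T2).
Hypotheses (mD1 : measurable D1) (mD2 : measurable D2).
Variable f : T1 * T2 -> \bar R.
Local Open Scope ereal_scope.

Let mD : measurable (D1 `*` D2) := measurableX mD1 mD2.

(** Extension by zero off a rectangle is extension by zero in each variable separately; this carries
    Fubini on the whole product over to rectangles. *)
Lemma restrict_setX (x : T1) (y : T2) :
  (f \_ (D1 `*` D2)) (x, y) = ((fun x => ((fun y => f (x, y)) \_ D2) y) \_ D1) x.
Proof.
have -> : (f \_ (D1 `*` D2)) (x, y) =
    if (x \in D1) && (y \in D2) then f (x, y) else 0.
  by rewrite patchE in_setX.
by rewrite !patchE; case: (x \in D1); case: (y \in D2).
Qed.

Lemma integral_restrict_setX1 :
  \int[m1]_x \int[m2]_y (f \_ (D1 `*` D2)) (x, y) =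
  \int[m1]_(x in D1) \int[m2]_(y in D2) f (x, y).
Proof.
rewrite [RHS]integral_mkcond; apply: eq_integral => x _.
rewrite [RHS]patchE; case: ifPn => xD.
  rewrite [RHS]integral_mkcond; apply: eq_integral => y _.
  by rewrite restrict_setX patchE xD patchE.
by apply: integral0_eq => y _; rewrite restrict_setX patchE (negbTE xD).
Qed.

Lemma integral_restrict_setX2 :
  \int[m2]_y \int[m1]_x (f \_ (D1 `*` D2)) (x, y) =
  \int[m2]_(y in D2) \int[m1]_(x in D1) f (x, y).
Proof.
rewrite [RHS]integral_mkcond; apply: eq_integral => y _.
rewrite [RHS]patchE; case: ifPn => yD.
  rewrite [RHS]integral_mkcond; apply: eq_integral => x _.
  by rewrite restrict_setX !patchE yD.
apply: integral0_eq => x _; rewrite restrict_setX !patchE (negbTE yD).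
by case: ifP.
Qed.

Lemma integral_setX1 : (m1 \x m2).-integrable (D1 `*` D2) f ->
  \int[m1 \x m2]_(z in D1 `*` D2) f z =
  \int[m1]_(x in D1) \int[m2]_(y in D2) f (x, y).
Proof.
move=> fi; rewrite integral_mkcond -integral12_prod_meas1.
  exact: integral_restrict_setX1.
exact/(integrable_mkcond _ mD).
Qed.

Lemma integral_setX2 : (m1 \x m2).-integrable (D1 `*` D2) f ->
  \int[m1 \x m2]_(z in D1 `*` D2) f z =
  \int[m2]_(y in D2) \int[m1]_(x in D1) f (x, y).
Proof.
move=> fi; rewrite integral_mkcond -integral21_prod_meas1.
  exact: integral_restrict_setX2.
exact/(integrable_mkcond _ mD).
Qed.

Let mfr : measurable_fun (D1 `*` D2) f ->
  measurable_fun setT (f \_ (D1 `*` D2)).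
Proof. by move=> mf; exact/(measurable_restrictT _ mD). Qed.

Lemma ge0_integral_setX1 : measurable_fun (D1 `*` D2) f ->
  (forall z, (D1 `*` D2) z -> 0 <= f z) ->
  \int[m1 \x m2]_(z in D1 `*` D2) f z =
  \int[m1]_(x in D1) \int[m2]_(y in D2) f (x, y).
Proof.
move=> mf f0; rewrite integral_mkcond fubini_tonelli1; last 2 first.
- exact: mfr.
- by move=> z; exact: erestrict_ge0.
exact: integral_restrict_setX1.
Qed.

Lemma ge0_integral_setX2 : measurable_fun (D1 `*` D2) f ->
  (forall z, (D1 `*` D2) z -> 0 <= f z) ->
  \int[m1 \x m2]_(z in D1 `*` D2) f z =
  \int[m2]_(y in D2) \int[m1]_(x in D1) f (x, y).
Proof.
move=> mf f0; rewrite integral_mkcond fubini_tonelli2; last 2 first.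
- exact: mfr.
- by move=> z; exact: erestrict_ge0.
exact: integral_restrict_setX2.
Qed.

End fubini_on_rectangles.

Section unit_cell.
Context {R : realType}.
Notation I := (`[0%R, 1%R[%classic : set (measurableTypeR R)).

Lemma measurable_unit_itv : measurable I.
Proof. exact: measurable_itv. Qed.

Lemma leb1_unit_itv : leb1 R I = 1%E.
Proof. by rewrite lebesgue_measure_itv/= lte01 oppr0 adde0. Qed.

Lemma measurable_cell : measurable (@cell R : set (measurableTypeR R * measurableTypeR R)).
Proof. by apply: measurableX; exact: measurable_itv. Qed.

Lemma leb2_cell : leb2 R cell = 1%E.
Proof.
rewrite /leb2 /cell product_measure1E; try exact: measurable_itv.
by rewrite -[RHS]mule1; congr (_ * _)%E; exact: leb1_unit_itv.
Qed.

Lemma torus_area1 : torus_area R = 1.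
Proof. by rewrite /torus_area leb2_cell. Qed.

Lemma integral_cell1 (f : R * R -> \bar R) : (leb2 R).-integrable cell f ->
  (\int[leb2 R]_(z in cell) f z = \int[leb1 R]_(x in I) \int[leb1 R]_(y in I) f (x, y))%E.
Proof.
by move=> fi; apply: (@integral_setX1 _ _ _ _ _ (leb1 R) (leb1 R)) => //; exact: measurable_itv.
Qed.

Lemma integral_cell2 (f : R * R -> \bar R) : (leb2 R).-integrable cell f ->
  (\int[leb2 R]_(z in cell) f z = \int[leb1 R]_(y in I) \int[leb1 R]_(x in I) f (x, y))%E.
Proof.
by move=> fi; apply: (@integral_setX2 _ _ _ _ _ (leb1 R) (leb1 R)) => //; exact: measurable_itv.
Qed.

End unit_cell.

(** * Functions orthogonal to all periodic tensor products *)

Section vanishing_integrals.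
Context d d' (T : measurableType d) (T' : measurableType d') (R : realType).
Variables (mu : {measure set T -> \bar R}) (F : T -> \bar R).
Hypothesis iF : mu.-integrable setT F.
Local Open Scope ereal_scope.

(** The sets [A] over which the integral vanishes form a Dynkin system: [C0] gives complements and
    countable additivity gives disjoint unions. The map [p] is later a projection, to enlarge one
    side of a rectangle at a time, and finally the identity. *)
Lemma dynkin_integral_eq0 (p : T -> T') (C : set T) (G : set (set T')) :
  measurable_fun setT p -> measurable C -> setI_closed G ->
  (@measurable _ T' = <<s G >>) -> \int[mu]_(z in C) F z = 0 ->
  (forall A, G A -> \int[mu]_(z in p @^-1` A `&` C) F z = 0) ->
  forall A, measurable A -> \int[mu]_(z in p @^-1` A `&` C) F z = 0.
Proof.
move=> mp mC GI mG C0 G0 A mA.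
have mpC B : measurable B -> measurable (p @^-1` B `&` C).
  by move=> mB; apply: measurableI => //; rewrite -[X in measurable X]setTI; exact: mp.
have iS B : measurable B -> mu.-integrable B F.
  by move=> mB; exact: integrableS iF.
pose H := [set B | measurable B /\ \int[mu]_(z in p @^-1` B `&` C) F z = 0].
suff GH : <<d G >> `<=` H.
  by have [] : H A by apply: GH; rewrite setI_closed_g_dynkin_g_sigma_algebra// -mG.
apply: smallest_sub; last first.
  by move=> B GB; split; [rewrite mG; exact: sub_sigma_algebra|exact: G0].
split.
- by split; [exact: measurableT|rewrite preimage_setT setTI].
- move=> B [mB B0]; split; first exact: measurableC.
  have : \int[mu]_(z in (p @^-1` B `&` C) `|` (p @^-1` (~` B) `&` C)) F z = 0.
    by rewrite -setIUl -preimage_setU setUv preimage_setT setTI.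
  have mB' : measurable (p @^-1` (~` B) `&` C) by exact/mpC/measurableC.
  rewrite integral_setU//; [by rewrite B0 add0e|exact: mpC| |].
  - apply: measurable_int (iS _ _); apply: measurableU => //; exact: mpC.
  - by apply/disj_setPS => z [[Bz _] [nBz _]].
- move=> B tB HB; split; first by apply: bigcupT_measurable => k; exact: (HB k).1.
  rewrite preimage_bigcup setI_bigcupl integral_bigcup.
  + by apply: eseries0 => k _ _; exact: (HB k).2.
  + move=> i j _ _ [z [[pi _] [pj _]]]; apply: (tB i j) => //; by exists (p z).
  + by move=> k; apply: mpC; exact: (HB k).1.
  + by apply: iS; apply: bigcupT_measurable => k; apply: mpC; exact: (HB k).1.
Qed.

End vanishing_integrals.

(** * Periodic smooth tensor products separate integrable functions on the cell *)

Section separation_by_test_functions.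
Context {R : realType}.
Notation mR := (measurableTypeR R).

Lemma measurable_rays : @measurable _ mR = <<s RGenOInfty.G (R:=R) >>.
Proof. exact: RGenOInfty.measurableE. Qed.

Lemma setI_closed_rays : setI_closed (RGenOInfty.G (R:=R)).
Proof.
move=> _ _ [x ->] [y ->]; exists (Num.max x y).
by apply/seteqP; split=> z /=; rewrite !in_itv/= !andbT gt_max => /andP.
Qed.

(* The period is 1 because both sines change sign under [x := x + 1]. *)
Definition arc (c x : R) : R := sin (pi * (x - c)) * sin (pi * (1 - x)).

Lemma SP_arc c : SP (arc c).
Proof.
split.
  have h (a b : R) : Cinf (fun x => sin (a * x + b)).
    by apply: (@Cinf_affine _ sin); exact: Cinf_sin.1.
  rewrite (_ : arc c = (fun x => sin (pi * x + (- (pi * c)))) \*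
                      (fun x => sin ((- pi) * x + pi))); first exact: CinfM.
  by apply/funext => x; rewrite /arc /=; congr (sin _ * sin _); ring.
move=> x; rewrite /arc.
have -> : pi * (x + 1 - c) = pi * (x - c) + pi by ring.
have -> : pi * (1 - (x + 1)) = pi * (1 - x) - pi by ring.
rewrite sinDpi -[in sin (_ - pi)](subrK pi (pi * (1 - x))).
have -> : pi * (1 - x) - pi + pi - pi = pi * (1 - x) - pi by ring.
have -> : sin (pi * (1 - x)) = - sin (pi * (1 - x) - pi).
  by rewrite -sinDpi subrK.
by rewrite mulNr mulrN.
Qed.

Lemma arc_gt0 c x : 0 <= c -> c < x < 1 -> 0 < arc c x.
Proof.
move=> c0 /andP[cx x1]; have p0 := pi_gt0 R.
by rewrite mulr_gt0// sin_gt0_pi//; apply/andP; split;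
  rewrite ?mulr_gt0 ?subr_gt0// -[ltRHS]mulr1 ltr_pM2l//; lra.
Qed.

Lemma arc_le0 c x : c < 1 -> 0 <= x <= c -> arc c x <= 0.
Proof.
move=> c1 /andP[x0 xc]; have p0 := pi_gt0 R.
rewrite mulr_le0_ge0//.
  rewrite -oppr_ge0 -sinN sin_ge0_pi// -mulrN opprB; apply/andP; split.
    by rewrite mulr_ge0 ?subr_ge0// ltW.
  by rewrite -[leRHS]mulr1 ler_pM2l//; lra.
rewrite sin_ge0_pi//; apply/andP; split.
  by rewrite mulr_ge0 ?subr_ge0// ltW//; lra.
by rewrite -[leRHS]mulr1 ler_pM2l//; lra.
Qed.

(** A ray is not periodic, so its indicator is approached only on [0, 1[. For 0 <= c < 1 the
    function [arc c] is positive on ]c, 1[ and nonpositive on [0, c], so [step (n * arc c x)] tends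
    to the indicator; for other [c] the indicator is constant on [0, 1[. *)
Lemma SP_approx_ray c : exists a : nat -> R -> R,
  [/\ forall n, SP (a n), forall n x, 0 <= a n x <= 1 &
      forall x, 0 <= x < 1 -> a n x @[n --> \oo] --> (\1_`]c, +oo[ x : R)].
Proof.
have [c0|c0] := ltP c 0.
  exists (fun=> cst 1); split => [n|n x|x /andP[x0 _]]; first exact: SP_cst.
    by rewrite /cst ler01 lexx.
  rewrite indicE mem_set; first exact: cvg_cst.
  by rewrite /= in_itv/= andbT (lt_le_trans c0).
have [c1|c1] := leP 1 c.
  exists (fun=> cst 0); split => [n|n x|x /andP[_ x1]]; first exact: SP_cst.
    by rewrite /cst ler01 lexx.
  rewrite indicE memNset; first exact: cvg_cst.
  by rewrite /= in_itv/= andbT => /(le_lt_trans c1)/(lt_trans x1); rewrite ltxx.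
exists (fun n x => step (n%:R * arc c x)); split => [n|n x|x /andP[x0 x1]].
- have [ca pa] := SP_arc c; split.
    by apply: (@Cinf_comp _ (fun x => n%:R * arc c x)); [exact: CinfZ|exact: Cinf_step].
  by move=> x; rewrite pa.
- by rewrite step_ge0 step_le1.
- have [cx|xc] := ltP c x.
    rewrite indicE mem_set; last by rewrite /= in_itv/= andbT.
    have a0 : 0 < arc c x by rewrite arc_gt0// cx.
    apply: cvg_near_cst; near=> n; rewrite step_ge1// -ler_pdivrMr//.
    by near: n; exact: nbhs_infty_ger.
  rewrite indicE memNset; last by rewrite /= in_itv/= andbT => /lt_geF; rewrite xc.
  rewrite (_ : (fun n => _) = cst 0); first exact: cvg_cst.
  apply/funext => n; rewrite step_le0// mulr_ge0_le0//.
  by rewrite arc_le0// x0.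
Unshelve. all: by end_near. Qed.

Variable w : R * R -> R.
Hypothesis iw : (leb2 R).-integrable cell (EFin \o w).
Hypothesis w_ortho : forall a b, SP a -> SP b ->
  torus_int (fun z => w z * tensor a b z) = 0.

Lemma measurable_tensor (a b : R -> R) : measurable_fun setT a ->
  measurable_fun setT b ->
  measurable_fun setT (tensor a b : mR * mR -> R).
Proof.
move=> ma mb; apply: measurable_funM.
  by apply: (@measurableT_comp _ _ _ _ _ _ a) => //; exact: measurable_fst.
by apply: (@measurableT_comp _ _ _ _ _ _ b) => //; exact: measurable_snd.
Qed.

Lemma integrable_cellMr (h : R * R -> R) (k : mR * mR -> R) (M : R) :
  (leb2 R).-integrable cell (EFin \o h) -> measurable_fun cell k ->
  (forall z, cell z -> `|k z| <= M) ->
  (leb2 R).-integrable cell (EFin \o (fun z => h z * k z)).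
Proof.
move=> ih mk bk; rewrite (_ : _ \o _ = (EFin \o h) \* (EFin \o k))%E//.
apply: integrableMl => //; first exact: measurable_cell.
exists M; split; first exact: num_real.
by move=> N MN z cz; exact: le_trans (bk z cz) (ltW MN).
Qed.

Lemma integral_rays_eq0 (c d : R) :
  (\int[leb2 R]_(z in cell) (w z * tensor \1_`]c, +oo[ \1_`]d, +oo[ z)%:E = 0)%E.
Proof.
have [a [sa ba ca]] := SP_approx_ray c.
have [b [sb bb cb]] := SP_approx_ray d.
have mt n : measurable_fun cell (tensor (a n) (b n) : mR * mR -> R).
  by apply: measurable_funTS; apply: measurable_tensor; apply: Cinf_measurable;
    [case: (sa n)|case: (sb n)].
have mi e : measurable_fun setT (\1_`]e, +oo[ : mR -> R).
  by apply: measurable_indic; exact: measurable_itv.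
have mw : measurable_fun cell w by apply/measurable_EFinP; exact: measurable_int iw.
(* The approximating factors take values in [0, 1], so [|w|] dominates. *)
have [] := @dominated_convergence _ _ _ (leb2 R) cell measurable_cell
  (fun n z => (w z * tensor (a n) (b n) z)%:E)
  (fun z => (w z * tensor \1_`]c, +oo[ \1_`]d, +oo[ z)%:E)
  (fun z => `|w z|%:E).
- by move=> n; apply/measurable_EFinP; exact: (measurable_funM mw (mt n)).
- apply/measurable_EFinP; apply: (measurable_funM mw).
  by apply: measurable_funTS; exact: measurable_tensor.
- apply: aeW => -[x y] [/= xI yI]; apply: cvg_EFin; first exact: nearW.
  apply: cvgM; first exact: cvg_cst.
  by apply: cvgM; [apply: ca|apply: cb]; rewrite ?in_itv in xI yI.
- exact: integrable_norm.
- apply: aeW => -[x y] n _; rewrite lee_fin normrM tensorE /=.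
  rewrite ler_piMr// normrM mulr_ile1//.
    by have /andP[a0 a1] := ba n x; rewrite ger0_norm.
  by have /andP[b0 b1] := bb n y; rewrite ger0_norm.
move=> _ _; rewrite (_ : (fun n => _) = cst 0%E).
  by move/cvg_lim => <-//; rewrite lim_cst.
apply/funext => n /=.
have it : (leb2 R).-integrable cell (EFin \o (fun z => w z * tensor (a n) (b n) z)).
  apply: (@integrable_cellMr _ _ 1) => // -[x y] _.
  rewrite tensorE /= normrM mulr_ile1//.
    by have /andP[a0 a1] := ba n x; rewrite ger0_norm.
  by have /andP[b0 b1] := bb n y; rewrite ger0_norm.
rewrite -[LHS]fineK; last exact: (integrable_fin_num measurable_cell it).
by have := w_ortho (sa n) (sb n); rewrite /torus_int /Rintegral => ->.
Qed.

Let F : R * R -> \bar R := (EFin \o w) \_ cell.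

Let iF : (leb2 R).-integrable setT F.
Proof. exact/(integrable_mkcond _ measurable_cell). Qed.

Let rectE (A B : set mR) : (\int[leb2 R]_(z in A `*` B) F z =
  \int[leb2 R]_(z in cell) (w z * tensor \1_A \1_B z)%:E)%E.
Proof.
rewrite integral_mkcond [RHS]integral_mkcond; apply: eq_integral => -[x y] _.
rewrite /F !patchE tensorE !indicE in_setX /=.
case: (x \in A); case: (y \in B); rewrite /= ?mulr1 ?mulr0 ?mul0r ?mulr0//.
all: by case: ifP.
Qed.

Let rays_eq0 (c d : R) : (\int[leb2 R]_(z in `]c, +oo[ `*` `]d, +oo[) F z = 0)%E.
Proof. by rewrite rectE; exact: integral_rays_eq0. Qed.

(** The Dynkin argument also asks for the integral over the full line. Since [F] vanishes off the
    cell, the ray from -1 does as well as the line, the value -1 being any number below 0. *)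
Let rectTr (B : set mR) :
  (\int[leb2 R]_(z in setT `*` B) F z = \int[leb2 R]_(z in `](-1)%R, +oo[ `*` B) F z)%E.
Proof.
rewrite !rectE; apply: eq_integral => -[x y] /set_mem[/= xI yI].
rewrite !tensorE !indicE/= in_setT [x \in _]mem_set//= in_itv/= andbT.
by move: xI; rewrite in_itv/= => /andP[x0 _]; rewrite (lt_le_trans _ x0)// ltrN10.
Qed.

Let rectTl (A : set mR) :
  (\int[leb2 R]_(z in A `*` setT) F z = \int[leb2 R]_(z in A `*` `](-1)%R, +oo[) F z)%E.
Proof.
rewrite !rectE; apply: eq_integral => -[x y] /set_mem[/= xI yI].
rewrite !tensorE !indicE/= in_setT [y \in _]mem_set//= in_itv/= andbT.
by move: yI; rewrite in_itv/= => /andP[y0 _]; rewrite (lt_le_trans _ y0)// ltrN10.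
Qed.

(** One side at a time: [h1] frees the first side while the second is a ray, then the second side is
    freed with [A] fixed. *)
Let rect_eq0 (A B : set mR) : measurable A -> measurable B ->
  (\int[leb2 R]_(z in A `*` B) F z = 0)%E.
Proof.
have h1 (d : R) (A' : set mR) : measurable A' ->
    (\int[leb2 R]_(z in A' `*` `]d, +oo[) F z = 0)%E.
  move=> mA'.
  have -> : A' `*` `]d, +oo[ = fst @^-1` A' `&` (setT `*` `]d, +oo[).
    by apply/seteqP; split => -[x y] /= []// ? [].
  apply: (@dynkin_integral_eq0 _ _ _ mR _ _ _ iF fst (setT `*` `]d, +oo[) (RGenOInfty.G (R:=R))) mA' => //.
  - exact: measurableX.
  - exact: setI_closed_rays.
  - exact: measurable_rays.
  - by rewrite rectTr.
  - move=> _ [c ->].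
    rewrite (_ : _ `&` _ = `]c, +oo[ `*` `]d, +oo[)//.
    by apply/seteqP; split => -[x y] /= []// ? [].
move=> mA mB.
have -> : A `*` B = snd @^-1` B `&` (A `*` setT).
  by apply/seteqP; split => -[x y] /= []// ? [].
apply: (@dynkin_integral_eq0 _ _ _ mR _ _ _ iF snd (A `*` setT) (RGenOInfty.G (R:=R))) mB => //.
- exact: measurableX.
- exact: setI_closed_rays.
- exact: measurable_rays.
- by rewrite rectTl h1.
- move=> _ [c ->].
  rewrite (_ : _ `&` _ = A `*` `]c, +oo[); first exact: h1.
  by apply/seteqP; split => -[x y] /= []// ? [].
Qed.

(** Measurable rectangles are stable under intersection and generate the product sigma-algebra, so
    the integral of [F] vanishes over every measurable set. *)
Lemma cell_ae_eq0 : {ae leb2 R, forall z, cell z -> w z = 0}.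
Proof.
have h E : measurable E -> (\int[leb2 R]_(z in E) F z = 0)%E.
  move=> mE; rewrite -(setIT E) -[X in X `&` _]preimage_id.
  apply: (dynkin_integral_eq0 iF
    (G := [set A `*` B | A in @measurable _ mR & B in @measurable _ mR])) mE => //.
  - move=> _ _ [A mA [B mB <-]] [A' mA' [B' mB' <-]].
    exists (A `&` A'); first exact: measurableI.
    by exists (B `&` B'); [exact: measurableI|rewrite setXI].
  - exact: measurable_prod_measurableType.
  - by rewrite -setXTT rect_eq0.
  - by move=> _ [A mA [B mB <-]]; rewrite setIT preimage_id rect_eq0.
have : ae_eq (leb2 R) setT F (cst 0%E).
  apply: integral_ae_eq => // E _ mE.
  by rewrite h// integral0.
apply: filterS => z /(_ I) + cz.
by rewrite /F patchE mem_set//= => -[].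
Qed.

End separation_by_test_functions.

(** * Fubini for an integrable function times a bounded kernel *)

Section fubini_on_rectangles2.
Context d1 d2 (T1 : measurableType d1) (T2 : measurableType d2) (R : realType).
Variables (m1 : {sigma_finite_measure set T1 -> \bar R})
          (m2 : {sigma_finite_measure set T2 -> \bar R}).
Variables (D1 : set T1) (D2 : set T2).
Hypotheses (mD1 : measurable D1) (mD2 : measurable D2).

Let mD : measurable (D1 `*` D2) := measurableX mD1 mD2.

Lemma integrable_fubini_setX2 (f : T1 * T2 -> \bar R) :
  (m1 \x m2)%E.-integrable (D1 `*` D2) f ->
  m2.-integrable D2 (fun y => \int[m1]_(x in D1) f (x, y))%E.
Proof.
move=> fi; apply/(integrable_mkcond _ mD2).
have fi' := (integrable_mkcond f mD).1 fi.
have mf := measurable_int _ fi'.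
suff : m2.-integrable setT (fubini_G m1 (f \_ (D1 `*` D2))).
  congr (integrable _ _ _); apply/funext => y; rewrite /fubini_G [RHS]patchE.
  case: ifPn => yD.
    rewrite [RHS]integral_mkcond; apply: eq_integral => x _.
    by rewrite restrict_setX !patchE yD.
  apply: integral0_eq => x _; rewrite restrict_setX !patchE (negbTE yD).
  by case: ifP.
apply/integrableP; split; first exact: (measurable_fubini_G fi').
apply: le_lt_trans ((integrable21ltyP m1 m2 mf).1 fi').
apply: ge0_le_integral => //.
- apply: measurableT_comp => //; exact: (measurable_fubini_G fi').
- apply: (@measurable_fun_fubini_tonelli_G _ _ _ _ _ m1 (abse \o (f \_ (D1 `*` D2)))) => [|z].
    exact: measurableT_comp.
  exact: abse_ge0.
- move=> y _; apply: le_abse_integral => //.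
  exact: (measurableT_comp mf (pair2_measurable y)).
Qed.

Lemma measurable_fst_setX d (T : measurableType d) (h : T1 -> T) :
  measurable_fun D1 h ->
  measurable_fun (D1 `*` D2) (fun z : T1 * T2 => h z.1).
Proof.
move=> mh; apply: (measurable_comp (F := D1)) => //.
- by move=> _ [[x y] [Dx _] <-].
- by apply: measurable_funTS; exact: measurable_fst.
Qed.

Lemma measurable_snd_setX d (T : measurableType d) (h : T2 -> T) :
  measurable_fun D2 h ->
  measurable_fun (D1 `*` D2) (fun z : T1 * T2 => h z.2).
Proof.
move=> mh; apply: (measurable_comp (F := D2)) => //.
- by move=> _ [[x y] [_ Dy] <-].
- by apply: measurable_funTS; exact: measurable_snd.
Qed.

Lemma measurable_section1 d (T : measurableType d) (f : T1 * T2 -> T) x :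
  D1 x -> measurable_fun (D1 `*` D2) f -> measurable_fun D2 (fun y => f (x, y)).
Proof.
move=> Dx mf; apply: (measurable_comp (F := D1 `*` D2)) => //.
- by move=> _ [y Dy <-].
- by apply: measurable_funTS; exact: pair1_measurable.
Qed.

Lemma measurable_section2 d (T : measurableType d) (f : T1 * T2 -> T) y :
  D2 y -> measurable_fun (D1 `*` D2) f -> measurable_fun D1 (fun x => f (x, y)).
Proof.
move=> Dy mf; apply: (measurable_comp (F := D1 `*` D2)) => //.
- by move=> _ [x Dx <-].
- by apply: measurable_funTS; exact: pair2_measurable.
Qed.

Variables (h : T1 -> R) (k : T1 * T2 -> R) (M : R).
Hypotheses (ih : m1.-integrable D1 (EFin \o h))
  (mk : measurable_fun (D1 `*` D2) k)
  (kM : forall z, (D1 `*` D2) z -> `|k z| <= M) (m2D2 : (m2 D2 < +oo)%E).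

Let mh : measurable_fun D1 h.
Proof. apply/measurable_EFinP; exact: (measurable_int m1 ih). Qed.

(** Adding a variable that ranges over a set of finite measure multiplies the integral of the
    absolute value by that measure. *)
Let ihf : (m1 \x m2)%E.-integrable (D1 `*` D2) (fun z => (h z.1)%:E).
Proof.
apply/integrableP; split; first by apply/measurable_EFinP; exact: (measurable_fst_setX mh).
rewrite ge0_integral_setX1//; last first.
  by apply: measurableT_comp => //; apply/measurable_EFinP; exact: (measurable_fst_setX mh).
rewrite (eq_integral (fun x => `|(h x)%:E| * m2 D2)%E); last first.
  by move=> x _; rewrite /= -(integral_cst m2 mD2).
have [r0 m2E] : exists r, m2 D2 = r%:E.
  by exists (fine (m2 D2)); rewrite fineK// ge0_fin_numE.
have /integrable_abse ih' := ih.
rewrite m2E integralZr//.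
rewrite muleC lte_mul_pinfty//; first by rewrite -m2E.
by case/integrableP: ih.
Qed.

Lemma integrable_kernel :
  (m1 \x m2)%E.-integrable (D1 `*` D2) (fun z => (h z.1 * k z)%:E).
Proof.
rewrite (_ : (fun z => _) = (fun z => (h z.1)%:E) \* (EFin \o k))%E//.
apply: integrableMl => //; exists M; split; first exact: num_real.
by move=> N MN z cz; exact: le_trans (kM cz) (ltW MN).
Qed.

Let mk1 x : D1 x -> measurable_fun D2 (fun y => k (x, y)).
Proof. by move=> Dx; exact: measurable_section1 Dx mk. Qed.

Let ik1 x : D1 x -> m2.-integrable D2 (EFin \o (fun y => k (x, y))).
Proof.
move=> Dx; apply: measurable_bounded_integrable => //; first exact: mk1.
exists M; split; first exact: num_real.
by move=> N MN y Dy; apply: le_trans (kM _) (ltW MN).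
Qed.

Let mk2 y : D2 y -> measurable_fun D1 (fun x => k (x, y)).
Proof. by move=> Dy; exact: measurable_section2 Dy mk. Qed.

Lemma integrable_kernel_section y : D2 y ->
  m1.-integrable D1 (EFin \o (fun x => h x * k (x, y))).
Proof.
move=> Dy; rewrite (_ : _ \o _ = (EFin \o h) \* (EFin \o (fun x => k (x, y))))%E//.
apply: integrableMl => //; first exact: mk2.
exists M; split; first exact: num_real.
by move=> N MN x Dx; apply: le_trans (kM _) (ltW MN).
Qed.

Lemma Rintegral_kernel1 :
  \int[(m1 \x m2)%E]_(z in D1 `*` D2) (h z.1 * k z) =
  \int[m1]_(x in D1) (h x * \int[m2]_(y in D2) k (x, y)).
Proof.
rewrite /Rintegral (integral_setX1 mD1 mD2 integrable_kernel); congr fine.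
apply: eq_integral => x /set_mem Dx /=.
under eq_integral do rewrite EFinM.
rewrite integralZl//; last exact: ik1.
rewrite EFinM fineK//.
exact: (integrable_fin_num mD2 (ik1 Dx)).
Qed.

Lemma Rintegral_kernel2 :
  \int[(m1 \x m2)%E]_(z in D1 `*` D2) (h z.1 * k z) =
  \int[m2]_(y in D2) \int[m1]_(x in D1) (h x * k (x, y)).
Proof.
rewrite /Rintegral (integral_setX2 mD1 mD2 integrable_kernel); congr fine.
apply: eq_integral => y /set_mem Dy /=.
by rewrite fineK//; exact: (integrable_fin_num mD1 (integrable_kernel_section Dy)).
Qed.

Lemma integrable_kernel2 : m2.-integrable D2
  (EFin \o (fun y => \int[m1]_(x in D1) (h x * k (x, y)))).
Proof.
apply: eq_integrable (integrable_fubini_setX2 integrable_kernel) => // y /set_mem Dy /=.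
by rewrite fineK//; exact: (integrable_fin_num mD1 (integrable_kernel_section Dy)).
Qed.

(** This is the exchange that moves an integral kernel from the test function onto the weak
    derivative. *)
Lemma Rintegral_kernel_swap :
  \int[m1]_(x in D1) (h x * \int[m2]_(y in D2) k (x, y)) =
  \int[m2]_(y in D2) \int[m1]_(x in D1) (h x * k (x, y)).
Proof. by rewrite -Rintegral_kernel1 Rintegral_kernel2. Qed.

End fubini_on_rectangles2.

Section sections_of_integrable_functions.
Context d1 d2 (T1 : measurableType d1) (T2 : measurableType d2) (R : realType).
Variables (m1 : {sigma_finite_measure set T1 -> \bar R})
          (m2 : {sigma_finite_measure set T2 -> \bar R}).
Variables (D1 : set T1) (D2 : set T2).
Hypotheses (mD1 : measurable D1) (mD2 : measurable D2).

Lemma ae_integrable_section2 (f : T1 * T2 -> \bar R) :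
  (m1 \x m2)%E.-integrable (D1 `*` D2) f ->
  {ae m2, forall y, D2 y -> m1.-integrable D1 (fun x => f (x, y))}.
Proof.
move=> fi; have mD := measurableX mD1 mD2.
have := ae_integrable2 ((integrable_mkcond f mD).1 fi).
apply: filterS => y iy Dy; apply/(integrable_mkcond _ mD1).
move: iy; congr (integrable _ _ _); apply/funext => x.
by rewrite restrict_setX !patchE (mem_set Dy).
Qed.

End sections_of_integrable_functions.

Section integrable_EFin.
Context d (T : measurableType d) (R : realType) (mu : {measure set T -> \bar R}).
Variables (D : set T).
Hypothesis mD : measurable D.
Implicit Types (f g : T -> R) (c : R).

Lemma integrable_EFinZ c f : mu.-integrable D (EFin \o f) ->
  mu.-integrable D (EFin \o (fun x => c * f x)).
Proof. by move=> fi; exact: (integrableZl mD c fi). Qed.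

Lemma integrable_EFinD f g : mu.-integrable D (EFin \o f) ->
  mu.-integrable D (EFin \o g) -> mu.-integrable D (EFin \o (fun x => f x + g x)).
Proof. by move=> fi gi; exact: (integrableD mD fi gi). Qed.

Lemma integrable_EFinB f g : mu.-integrable D (EFin \o f) ->
  mu.-integrable D (EFin \o g) -> mu.-integrable D (EFin \o (fun x => f x - g x)).
Proof. by move=> fi gi; exact: (integrableB mD fi gi). Qed.

Lemma integrable_EFin_measurable f : mu.-integrable D (EFin \o f) ->
  measurable_fun D f.
Proof. by move=> fi; apply/measurable_EFinP; exact: (measurable_int mu fi). Qed.

Lemma integrable_bounded f c : (mu D < +oo)%E -> measurable_fun D f ->
  (forall x, D x -> `|f x| <= c) -> mu.-integrable D (EFin \o f).
Proof.
move=> Dy mf fc; apply: measurable_bounded_integrable => //.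
exists c; split; first exact: num_real.
by move=> N cN x Dx; exact: le_trans (fc _ Dx) (ltW cN).
Qed.

Lemma integrable_EFinM f g c : mu.-integrable D (EFin \o f) ->
  measurable_fun D g -> (forall x, D x -> `|g x| <= c) ->
  mu.-integrable D (EFin \o (fun x => f x * g x)).
Proof.
move=> fi mg gc; apply: (integrableMl mD fi mg).
exists c; split; first exact: num_real.
by move=> N cN x Dx; exact: le_trans (gc _ Dx) (ltW cN).
Qed.

Lemma integrable_EFin_cst c : (mu D < +oo)%E -> mu.-integrable D (EFin \o cst c).
Proof. by move=> Dy; exact: (@integrable_bounded (cst c) `|c|). Qed.

End integrable_EFin.

(** * Square-integrable functions on a set of mass one *)

Section square_integrable.
Context d (T : measurableType d) (R : realType) (mu : {measure set T -> \bar R}).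
Variables (D : set T).
Hypotheses (mD : measurable D) (muD : mu D = 1%E).

Definition L2on (f : T -> R) := measurable_fun D f /\
  mu.-integrable D (EFin \o (fun x => f x ^+ 2)).

Lemma L2on_integrable f : L2on f -> mu.-integrable D (EFin \o f).
Proof.
move=> [mf f2].
have i1 : mu.-integrable D (EFin \o cst 1).
  by apply: integrable_EFin_cst; rewrite ?muD ?ltry.
apply: le_integrable (integrableD mD i1 f2) => //; first exact/measurable_EFinP.
move=> x Dx /=; rewrite lee_fin [leRHS]ger0_norm ?addr_ge0 ?ler01 ?sqr_ge0//.
rewrite -[in leRHS](real_normK (num_real (f x))).
have := sqr_ge0 (`|f x| - 1); have := normr_ge0 (f x); nra.
Qed.

(** Nonnegativity of the variance: expand the integral of (f - m)^2, using that [D] has mass 1. *)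
Lemma sqr_Rintegral_le f : L2on f ->
  (\int[mu]_(x in D) f x) ^+ 2 <= \int[mu]_(x in D) f x ^+ 2.
Proof.
move=> f2; have fi := L2on_integrable f2; case: f2 => mf f2.
set m := \int[mu]_(x in D) f x.
have h : 0 <= \int[mu]_(x in D) (f x - m) ^+ 2 by apply: Rintegral_ge0 => x _; exact: sqr_ge0.
have ic (c : R) : mu.-integrable D (EFin \o cst c).
  by apply: integrable_EFin_cst; rewrite ?muD ?ltry.
have i2 : mu.-integrable D (EFin \o (fun x => (- 2 * m) * f x)).
  exact: integrable_EFinZ.
have e : \int[mu]_(x in D) (f x - m) ^+ 2 =
    \int[mu]_(x in D) (f x ^+ 2 + ((- 2 * m) * f x + m ^+ 2)).
  by apply: eq_Rintegral => x _; ring.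
rewrite e RintegralD// in h; last exact: (integrable_EFinD mD i2 (ic _)).
rewrite RintegralD// in h; last exact: ic.
rewrite RintegralZl// Rintegral_cst// muD/= -/m in h.
lra.
Qed.

(** Meant for [f] equal to [g] times a kernel bounded by 1. The right side is an extended real
    because the weak derivative [g] may fail to be square integrable, in which case the bound is
    trivial. *)
Lemma sqr_Rintegral_lee (f g : T -> R) : measurable_fun D f -> measurable_fun D g ->
  (forall x, D x -> `|f x| <= `|g x|) ->
  (((\int[mu]_(x in D) f x) ^+ 2)%:E <= \int[mu]_(x in D) (g x ^+ 2)%:E)%E.
Proof.
move=> mf mg fg.
have sq x : D x -> f x ^+ 2 <= g x ^+ 2.
  by move=> Dx; rewrite -(real_normK (num_real (f x))) -(real_normK (num_real (g x))) lerXn2r ?nnegrE// fg.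
have mX (u : T -> R) : measurable_fun D u -> measurable_fun D (fun x => u x ^+ 2).
  by move=> mu'; exact: measurable_funX.
have [gy|gy] := eqVneq (\int[mu]_(x in D) (g x ^+ 2)%:E)%E +oo%E.
  by rewrite gy leey.
have g2 : mu.-integrable D (EFin \o (fun x => g x ^+ 2)).
  apply/integrableP; split; first exact/measurable_EFinP/mX.
  under eq_integral do rewrite gee0_abs ?lee_fin ?sqr_ge0//.
  by rewrite ltey.
have f2 : mu.-integrable D (EFin \o (fun x => f x ^+ 2)).
  apply: le_integrable g2 => //; first exact/measurable_EFinP/mX.
  by move=> x Dx /=; rewrite lee_fin !ger0_norm ?sqr_ge0// sq.
apply: (@le_trans _ _ (\int[mu]_(x in D) (f x ^+ 2)%:E)%E).
  rewrite -[leRHS]fineK; last exact: (integrable_fin_num mD f2).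
  by rewrite lee_fin; exact: sqr_Rintegral_le.
apply: ge0_le_integral => //.
- by move=> x _; rewrite lee_fin sqr_ge0.
- exact/measurable_EFinP/mX.
- exact/measurable_EFinP/mX.
Qed.

End square_integrable.

(** * The Poincare inequality on the torus *)

Section periodic_primitive.
Context {R : realType}.
Notation mu := (@lebesgue_measure R).
Notation I := (`[0%R, 1%R[%classic : set (measurableTypeR R)).

Lemma continuous_integrable_itv (a : R -> R) (c u : R) : continuous a ->
  mu.-integrable `[c, u] (EFin \o a).
Proof.
move=> ca; apply: continuous_compact_integrable; first exact: segment_compact.
exact: continuous_subspaceT.
Qed.

Lemma continuous_integrable_unit (a : R -> R) : continuous a ->
  mu.-integrable I (EFin \o a).
Proof.
move=> ca; apply: integrableS (continuous_integrable_itv 0 1 ca) => //.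
by apply: subset_itvl; rewrite bnd_simp.
Qed.

(** The oriented integral from 0 to [x]: for either sign of [x] one of the two intervals is empty,
    and at 0 both are a point. *)
Definition primitive (a : R -> R) (x : R) : R :=
  \int[mu]_(t in `[0, x]) a t - \int[mu]_(t in `[x, 0]) a t.

Lemma primitiveE (a : R -> R) (c x : R) : continuous a -> c <= 0 -> c <= x ->
  primitive a x = \int[mu]_(t in `[c, x]) a t - \int[mu]_(t in `[c, 0]) a t.
Proof.
move=> ca c0 cx.
have h (y z : R) : c <= y -> y <= z -> \int[mu]_(t in `[c, z]) a t -
    \int[mu]_(t in `[c, y]) a t = \int[mu]_(t in `[y, z]) a t.
  move=> cy yz; rewrite Rintegral_itvB ?bnd_simp//; last exact: continuous_integrable_itv.
  rewrite Rintegral_itv_obnd_cbnd//.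
  apply: integrableS (continuous_integrable_itv y z ca) => //.
  by apply: subset_itvr; rewrite bnd_simp.
have set0itv (y z : R) : z < y -> `[y, z]%classic = set0 :> set R.
  by move=> zy; rewrite set_itv_ge// bnd_simp -ltNge.
rewrite /primitive; have [x0|x0|<-] := ltgtP 0 x.
- by rewrite h ?(ltW x0)// (set0itv _ _ x0) Rintegral_set0 subr0.
- by rewrite -[RHS]opprB h ?(ltW x0)// (set0itv _ _ x0) Rintegral_set0 sub0r.
- by rewrite !subrr.
Qed.

Lemma is_derive_primitive (a : R -> R) (x : R) : continuous a ->
  is_derive x (1 : R) (primitive a) (a x).
Proof.
(* A base point strictly left of both [x] and 0, so that near [x] the primitive is an integral with
   fixed lower end [c], up to a constant. *)
move=> ca; pose c := Num.min x 0 - 1.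
have cx : c < x by rewrite /c ltrBlDr gt_min ?ltrDl ?ltr01 ?orbT//.
have c0 : c < 0 by rewrite /c ltrBlDr gt_min ?ltrDl ?ltr01 ?orbT//.
have [dF F'] := @continuous_FTC1_closed R a c x (x + 1) (ltr_pwDr ltr01 (lexx x))
  (continuous_integrable_itv _ _ ca) cx (ca x).
apply: (@near_eq_is_derive R R R
    (fun y => \int[mu]_(t in `[c, y]) a t - \int[mu]_(t in `[c, 0]) a t)).
  near=> y; rewrite (@primitiveE _ c) ?(ltW c0)//.
  by apply/ltW; near: y; exact: lt_nbhsr.
rewrite -[a x]subr0 -F' derive1E.
apply: is_deriveB.
exact: derivableP.
Unshelve. all: by end_near. Qed.

Definition imean (a : R -> R) : R := \int[mu]_(t in I) a t.

(** The indicator integrates from 0 to [x]; the term [- x] subtracts the linear growth, with slope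
    the mean, that would spoil periodicity. *)
Definition kern (x s : R) : R := (s < x)%R%:R - x.

Lemma measurable_kern :
  measurable_fun setT (fun z : measurableTypeR R * measurableTypeR R => kern z.1 z.2).
Proof.
apply: measurable_funB; last exact: measurable_fst.
rewrite (_ : (fun _ => _) = fun z : R * R => if (z.2 < z.1)%R then 1 else 0).
  apply: measurable_fun_ifT => //; apply: measurable_fun_ltr.
    exact: measurable_snd.
  exact: measurable_fst.
by apply/funext => z; case: ltP.
Qed.

Lemma kern_le1 x s : I x -> `|kern x s| <= 1.
Proof.
rewrite /= in_itv/= => /andP[x0 x1]; rewrite /kern ler_norml.
by case: (s < x)%R => /=; apply/andP; split; lra.
Qed.

Lemma SP_primitive (a : R -> R) : SP a -> exists Phi, [/\ SP Phi,
  forall x, Phi^`()%classic x = a x - imean a &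
  forall x, I x -> Phi x = \int[mu]_(s in I) (kern x s * a s)].
Proof.
move=> [ca pa]; have cta := Cinf_continuous ca.
pose Phi x := primitive a x - imean a * x.
have dPhi x : is_derive x (1 : R) Phi (a x - imean a).
  apply: is_deriveB; first exact: is_derive_primitive.
  rewrite -[X in is_derive _ _ _ X](mulr1 (imean a)).
  exact: (@is_deriveZ _ _ _ id).
have Phi1 x : Phi (x + 1) = Phi x.
  (* [D] has zero derivative because [a] is periodic, and [D 0] vanishes because the integral of [a]
     over one period is its mean. *)
  pose D y := Phi (y + 1) - Phi y.
  have D0 y : is_derive y (1 : R) D 0.
    rewrite (_ : 0 = (a (y + 1) - imean a) * 1 - (a y - imean a)).
      apply: is_deriveB.
      apply: (@is_derive1_comp _ Phi (fun y => y + 1)).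
      exact: is_derive_shift.
    by rewrite pa mulr1 subrr.
  suff : D x = 0 by move/eqP; rewrite subr_eq0 => /eqP.
  rewrite (is_derive_0_is_cst x 0 D0) /D /Phi add0r mulr0 subr0 mulr1.
  rewrite !(@primitiveE _ 0)// set_itv1 Rintegral_set1 !subr0.
  rewrite /imean Rintegral_itv_bndo_bndc ?subrr//.
  exact: continuous_integrable_unit.
exists Phi; split.
- split=> //; apply: (@Cinf_of_derive _ _ (fun x => a x - imean a)) => //.
  exact: (CinfB ca (Cinf_cst (imean a))).
- by move=> x; rewrite derive1E; exact: derive_val.
- move=> x Ix; have /andP[x0 x1] : 0 <= x < 1 by move: Ix; rewrite /= in_itv.
  have ia := continuous_integrable_unit cta.
  rewrite (_ : \int[mu]_(s in I) (kern x s * a s) =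
    \int[mu]_(s in I) ((a \_ `[0, x[) s - x * a s)); last first.
    apply: eq_Rintegral => s /set_mem Is; rewrite /kern mulrBl patchE; congr (_ - _).
    have s0 : 0 <= s by move: Is; rewrite /= in_itv/= => /andP[].
    have -> : (s \in `[0, x[%classic) = (s < x) by rewrite mem_setE in_itv/= s0.
    by case: ltP; rewrite ?mul1r ?mul0r.
  have ix : mu.-integrable I (EFin \o (a \_ `[0, x[)).
    rewrite -restrict_EFin; apply/integrable_restrict => //.
    by apply: integrableS ia => //; apply: measurableI; exact: measurable_itv.
  rewrite RintegralB//; last exact: integrable_EFinZ.
  rewrite RintegralZl// -/(imean a) -Rintegral_mkcondr mulrC setIidr; last first.
    by apply: subset_itvl; rewrite bnd_simp ltW.
  congr (_ - _); rewrite (@primitiveE _ 0)// set_itv1 Rintegral_set1 subr0.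
  rewrite Rintegral_itv_bndo_bndc//; apply: integrableS ia => //.
  by apply: subset_itvl; rewrite bnd_simp ltW.
Qed.

End periodic_primitive.

(** * The representation of a function by its weak gradient, and the inequality *)

Section poincare.
Context {R : realType}.
Notation mR := (measurableTypeR R).
Notation mu := (@lebesgue_measure R).
Notation I := (`[0%R, 1%R[%classic : set mR).
Variables f g1 g2 : R * R -> R.
Hypotheses (wp1 : weak_partial (1%N, 0%N) f g1)
           (wp2 : weak_partial (0%N, 1%N) f g2).

Let mI : measurable I := measurable_unit_itv.
Let mC : measurable (@cell R : set (mR * mR)) := measurable_cell.
Let iF : (leb2 R).-integrable cell (EFin \o f). Proof. by case: wp1. Qed.
Let ig1 : (leb2 R).-integrable cell (EFin \o g1). Proof. by case: wp1. Qed.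
Let ig2 : (leb2 R).-integrable cell (EFin \o g2). Proof. by case: wp2. Qed.
Let mf : measurable_fun cell f. Proof. exact: integrable_EFin_measurable iF. Qed.
Let mg1 : measurable_fun cell g1. Proof. exact: integrable_EFin_measurable ig1. Qed.
Let mg2 : measurable_fun cell g2. Proof. exact: integrable_EFin_measurable ig2. Qed.

Let muIy : (mu I < +oo)%E. Proof. by rewrite leb1_unit_itv ltry. Qed.
Let muCy : (leb2 R cell < +oo)%E. Proof. by rewrite leb2_cell ltry. Qed.

Lemma weak_tensor1 (a b : R -> R) : SP a -> SP b ->
  torus_int (fun z => f z * (a^`()%classic z.1 * b z.2)) =
  - torus_int (fun z => g1 z * tensor a b z).
Proof.
move=> [ca pa] [cb pb]; case: wp1 => _ _ /(_ (tensor a b)).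
rewrite addn0 expr1 mulN1r => <-; last 2 first.
- exact: smooth_tensor.
- exact: torus_periodic_tensor.
apply: eq_Rintegral => z _; congr (_ * _).
by rewrite /iter_derive/= /basis2/= derive_tensor//= mul1r mul0r addr0.
Qed.

Lemma weak_tensor2 (a b : R -> R) : SP a -> SP b ->
  torus_int (fun z => f z * (a z.1 * b^`()%classic z.2)) =
  - torus_int (fun z => g2 z * tensor a b z).
Proof.
move=> [ca pa] [cb pb]; case: wp2 => _ _ /(_ (tensor a b)).
rewrite add0n expr1 mulN1r => <-; last 2 first.
- exact: smooth_tensor.
- exact: torus_periodic_tensor.
apply: eq_Rintegral => z _; congr (_ * _).
by rewrite /iter_derive/= /basis2/= derive_tensor//= mul1r mul0r add0r.
Qed.

Lemma SP_bounded (a : R -> R) : SP a -> exists M, forall x, I x -> `|a x| <= M.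
Proof.
move=> [ca _]; have cn : {within `[0, 1], continuous (fun x => `|a x|)}.
  apply: continuous_subspaceT => x.
  by apply: continuous_comp; [exact: Cinf_continuous|exact: norm_continuous].
have [c _ hc] := EVT_max (@ler01 R) cn.
exists `|a c| => x Ix; apply: hc; move: Ix; rewrite /= !in_itv/= => /andP[-> x1].
exact: ltW.
Qed.

Let msp (a : R -> R) : SP a -> measurable_fun I a.
Proof. by move=> [ca _]; apply: measurable_funTS; exact: Cinf_measurable. Qed.

Let mten (a b : R -> R) : SP a -> SP b ->
  measurable_fun cell (tensor a b : mR * mR -> R).
Proof.
move=> [ca _] [cb _]; apply: measurable_funTS.
by apply: measurable_tensor; exact: Cinf_measurable.
Qed.

Let bten (a b : R -> R) : SP a -> SP b ->
  exists M, forall z, cell z -> `|tensor a b z| <= M.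
Proof.
move=> /SP_bounded[M Ma] /SP_bounded[N Nb]; exists (M * N) => -[x y] [Ix Iy].
by rewrite tensorE normrM ler_pM//=; [exact: Ma|exact: Nb].
Qed.

Let imt (h : R * R -> R) (a b : R -> R) : (leb2 R).-integrable cell (EFin \o h) ->
  SP a -> SP b ->
  (leb2 R).-integrable cell (EFin \o (fun z => h z * tensor a b z)).
Proof.
move=> ih sa sb; have [M hM] := bten sa sb.
exact: (integrable_EFinM mC ih (mten sa sb) hM).
Qed.

(** The asymmetry of [G1] and [G2] comes from treating the first variable first: in the second step
    [a] has already been replaced by its mean, so [g2] is averaged over the first variable too and
    [G2] depends on one variable only. *)
Let G1 (z : R * R) : R := \int[mu]_(x in I) (g1 (x, z.2) * kern x z.1).
Let G2 (t : R) : R := \int[leb2 R]_(z in cell) (g2 z * kern z.2 t).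

Let mkern1 (s : R) : measurable_fun cell (fun z : mR * mR => kern z.1 s).
Proof.
apply: measurable_funTS.
apply: (@measurableT_comp _ _ _ _ _ _ (fun z : mR * mR => kern z.1 z.2) setT
  (fun z : mR * mR => (z.1, s))); first exact: measurable_kern.
by apply: measurable_fun_pair => //; exact: measurable_fst.
Qed.

Let mkern2 (s : R) : measurable_fun cell (fun z : mR * mR => kern z.2 s).
Proof.
apply: measurable_funTS.
apply: (@measurableT_comp _ _ _ _ _ _ (fun z : mR * mR => kern z.1 z.2) setT
  (fun z : mR * mR => (z.2, s))); first exact: measurable_kern.
by apply: measurable_fun_pair => //; exact: measurable_snd.
Qed.

Let dual2 (b Phi : R -> R) : SP b ->
  (forall x, I x -> Phi x = \int[mu]_(s in I) (kern x s * b s)) ->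
  torus_int (fun z => g2 z * Phi z.2) = \int[mu]_(t in I) (G2 t * b t).
Proof.
move=> sb PhiE; have [M hM] := SP_bounded sb.
rewrite /torus_int.
pose k (zs : (mR * mR) * mR) := kern zs.1.2 zs.2 * b zs.2.
have mk : measurable_fun (cell `*` I) k.
  apply: measurable_funM.
    apply: measurable_funTS.
    apply: (@measurableT_comp _ _ _ _ _ _ (fun z : mR * mR => kern z.1 z.2) setT
      (fun z : (mR * mR) * mR => (z.1.2, z.2))); first exact: measurable_kern.
    apply: measurable_fun_pair; last exact: measurable_snd.
    by apply: (@measurableT_comp _ _ _ _ _ _ snd).
  by apply: measurable_snd_setX => //; exact: msp.
have bk z : (cell `*` I) z -> `|k z| <= M.
  move: z => [[x y] s] [[/= Ix Iy] Is]; rewrite /k normrM/=.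
  rewrite -[leRHS]mul1r ler_pM//; [exact: kern_le1|exact: hM].
have := @Rintegral_kernel_swap _ _ (mR * mR)%type mR R (leb2 R) mu cell I mC mI g2 k M
  ig2 mk bk muIy.
rewrite /k /= => e.
transitivity (\int[leb2 R]_(z in cell) (g2 z * \int[mu]_(s in I) (kern z.2 s * b s))).
  by apply: eq_Rintegral => -[x y] /set_mem[Ix Iy]; rewrite PhiE.
rewrite e; apply: eq_Rintegral => s /set_mem Is; rewrite /G2 -RintegralZr//.
  by apply: eq_Rintegral => z _; rewrite mulrA.
apply: (integrable_EFinM (c := 1) mC ig2 (mkern2 s)).
by move=> [x y] [Ix Iy]; exact: kern_le1.
Qed.

Let bG2 t : `|G2 t| <= \int[leb2 R]_(z in cell) `|g2 z|.
Proof.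
have i2 : (leb2 R).-integrable cell (EFin \o (fun z => g2 z * kern z.2 t)).
  apply: (integrable_EFinM (c := 1) mC ig2 (mkern2 t)).
  by move=> [x y] [Ix Iy]; exact: kern_le1.
apply: le_trans (le_normr_Rintegral mC i2) _.
apply: le_Rintegral => //; [exact: integrable_norm|exact: integrable_norm|].
by move=> [x y] [Ix Iy]; rewrite normrM ler_piMr//; exact: kern_le1.
Qed.

Let iG2 : mu.-integrable I (EFin \o G2).
Proof.
pose k (zs : (mR * mR) * mR) := kern zs.1.2 zs.2.
have mk : measurable_fun (cell `*` I) k.
  apply: measurable_funTS.
  apply: (@measurableT_comp _ _ _ _ _ _ (fun z : mR * mR => kern z.1 z.2) setT
    (fun z : (mR * mR) * mR => (z.1.2, z.2))); first exact: measurable_kern.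
  apply: measurable_fun_pair; last exact: measurable_snd.
  by apply: (@measurableT_comp _ _ _ _ _ _ snd).
have bk z : (cell `*` I) z -> `|k z| <= 1.
  by move: z => [[x y] s] [[/= Ix Iy] Is]; exact: kern_le1.
exact: (@integrable_kernel2 _ _ (mR * mR)%type mR R (leb2 R) mu cell I mC mI g2 k 1
  ig2 mk bk muIy).
Qed.

Let mI3 (F : mR * mR -> R) : measurable_fun cell F ->
  measurable_fun (I `*` cell) (fun w : mR * (mR * mR) => F (w.1, w.2.2)).
Proof.
move=> mF; apply: (measurable_comp (F := cell)) => //.
- by move=> _ [[x [s y]] [/= Ix [_ Iy]] <-].
- apply: measurable_funTS; apply: measurable_fun_pair; first exact: measurable_fst.
  by apply: (@measurableT_comp _ _ _ _ _ _ snd).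
Qed.

(** In three variables, (x, (s, y)) -> g1 (x, y) * kern x s is integrable, since [s] ranges over an
    interval of mass 1 and the kernel is bounded; integrating out [x] leaves an integrable function
    of (s, y). The statement is about the extended-real integral, of which [G1] is the real part. *)
Let iG1e : (leb2 R).-integrable cell
  (fun z => \int[mu]_(x in I) (g1 (x, z.2) * kern x z.1)%:E)%E.
Proof.
have i0 : (mu \x leb2 R)%E.-integrable (I `*` cell)
    (EFin \o (fun w : mR * (mR * mR) => g1 (w.1, w.2.2))).
  have mw := mI3 mg1.
  apply/integrableP; split; first exact/measurable_EFinP.
  have mabs : measurable_fun (I `*` cell) (abse \o (EFin \o (fun w : mR * (mR * mR) => g1 (w.1, w.2.2)))).
    by apply: measurableT_comp => //; exact/measurable_EFinP.
  rewrite (ge0_integral_setX1 _ _ mI mC)//.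
  have mabs2 : measurable_fun cell (abse \o (EFin \o g1)).
    by apply: measurableT_comp => //; exact/measurable_EFinP.
  case/integrableP : ig1 => _; apply: le_lt_trans.
  rewrite [leRHS](@ge0_integral_setX1 _ _ _ _ _ mu mu)//.
  rewrite le_eqVlt; apply/orP; left; apply/eqP; apply: eq_integral => x /set_mem Ix.
  rewrite (@ge0_integral_setX1 _ _ _ _ _ mu mu)//; last first.
    exact: (measurable_section1 mI mC Ix mabs).
  pose c := (\int[mu]_(y in I) `|(g1 (x, y))%:E|)%E.
  transitivity (c * mu I)%E; first exact: (integral_cst mu mI c).
  by rewrite leb1_unit_itv mule1.
have mk : measurable_fun (I `*` cell) (fun w : mR * (mR * mR) => kern w.1 w.2.1).
  apply: measurable_funTS.
  apply: (@measurableT_comp _ _ _ _ _ _ (fun z : mR * mR => kern z.1 z.2) setT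
    (fun w : mR * (mR * mR) => (w.1, w.2.1))); first exact: measurable_kern.
  apply: measurable_fun_pair; first exact: measurable_fst.
  by apply: (@measurableT_comp _ _ _ _ _ _ fst).
have i3 : (mu \x leb2 R)%E.-integrable (I `*` cell)
    (EFin \o (fun w : mR * (mR * mR) => g1 (w.1, w.2.2) * kern w.1 w.2.1)).
  apply: (integrable_EFinM (c := 1) (measurableX mI mC) i0 mk).
  by move=> [x z] [Ix _]; exact: kern_le1.
exact: (integrable_fubini_setX2 mI mC i3).
Qed.

Let iG1 : (leb2 R).-integrable cell (EFin \o G1).
Proof.
apply: le_integrable iG1e => //.
  apply/measurable_EFinP; rewrite /G1 /Rintegral.
  apply: (@measurableT_comp _ _ _ _ _ _ (@fine R)) => //.
  exact: measurable_int iG1e.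
(* [fine] sends infinite values to 0, so passing to the real integral only decreases the absolute
   value. *)
by move=> z _; rewrite /= /G1 /Rintegral; case: (integral _ _ _) => [r| |] //=;
  rewrite normr0 leey.
Qed.

Let dual1 (a b Phi : R -> R) : SP a -> SP b ->
  (forall x, I x -> Phi x = \int[mu]_(s in I) (kern x s * a s)) ->
  torus_int (fun z => g1 z * tensor Phi b z) = torus_int (fun z => G1 z * tensor a b z).
Proof.
move=> sa sb PhiE; have [M hM] := SP_bounded sa; have [N hN] := SP_bounded sb.
have iab s : I s -> (leb2 R).-integrable cell
    (EFin \o (fun z => g1 z * (kern z.1 s * (a s * b z.2)))).
  move=> Is; apply: (@integrable_EFinM _ _ _ _ _ _ _ _ (1 * (M * N))) => //.
    apply: measurable_funM; first exact: mkern1.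
    apply: measurable_funM; first exact: measurable_cst.
    by apply: measurable_snd_setX => //; exact: msp.
  move=> [x y] [Ix Iy]; rewrite !normrM; apply: ler_pM => //; first exact: kern_le1.
  by apply: ler_pM => //; [exact: hM|exact: hN].
pose k (zs : (mR * mR) * mR) := kern zs.1.1 zs.2 * (a zs.2 * b zs.1.2).
have mk : measurable_fun (cell `*` I) k.
  apply: measurable_funM.
    apply: measurable_funTS.
    apply: (@measurableT_comp _ _ _ _ _ _ (fun z : mR * mR => kern z.1 z.2) setT
      (fun z : (mR * mR) * mR => (z.1.1, z.2))); first exact: measurable_kern.
    apply: measurable_fun_pair; last exact: measurable_snd.
    by apply: (@measurableT_comp _ _ _ _ _ _ fst).
  apply: measurable_funM; first by apply: measurable_snd_setX => //; exact: msp.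
  apply: measurable_funTS.
  apply: (@measurableT_comp _ _ _ _ _ _ b); first by case: sb => /Cinf_measurable.
  by apply: (@measurableT_comp _ _ _ _ _ _ snd).
have bk z : (cell `*` I) z -> `|k z| <= 1 * (M * N).
  move: z => [[x y] s] [[/= Ix Iy] Is]; rewrite /k !normrM/=.
  by rewrite ler_pM//; [exact: kern_le1|rewrite ler_pM//; [exact: hM|exact: hN]].
have := @Rintegral_kernel_swap _ _ (mR * mR)%type mR R (leb2 R) mu cell I mC mI g1 k _
  ig1 mk bk muIy.
rewrite /k /= => e.
transitivity (\int[leb2 R]_(z in cell)
    (g1 z * \int[mu]_(s in I) (kern z.1 s * (a s * b z.2)))).
  apply: eq_Rintegral => -[x y] /set_mem[Ix Iy]; rewrite tensorE/= PhiE// -RintegralZr//.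
    by congr (_ * _); apply: eq_Rintegral => s _; rewrite mulrA.
  apply: (@integrable_bounded _ _ _ _ _ _ _ (1 * M)) => //.
    apply: measurable_funM; last exact: msp.
    apply: (@measurableT_comp _ _ _ _ _ _ (fun z : mR * mR => kern z.1 z.2) _
      (fun s : mR => (x, s))); first exact: measurable_kern.
    by apply: measurable_funTS; exact: measurable_fun_pair.
  by move=> s Is; rewrite normrM ler_pM//; [exact: kern_le1|exact: hM].
rewrite e /torus_int /Rintegral; congr fine.
rewrite (integral_cell1 (imt iG1 sa sb)); apply: eq_integral => s /set_mem Is.
rewrite fineK; last exact: (integrable_fin_num mC (iab s Is)).
rewrite (integral_cell2 (iab s Is)).
have ik : (leb2 R).-integrable cell (EFin \o (fun z => g1 z * kern z.1 s)).
  apply: (integrable_EFinM (c := 1) mC ig1 (mkern1 s)).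
  by move=> [x y] [Ix Iy]; exact: kern_le1.
apply: ae_eq_integral => //.
- by have /(measurable_int mu) := @integrable_fubini_setX2 _ _ _ _ _ mu mu _ _ mI mI _ (iab s Is).
- apply/measurable_EFinP; apply: measurable_funM.
    rewrite /G1 /Rintegral/=; apply: (@measurableT_comp _ _ _ _ _ _ (@fine R)) => //.
    by have /(measurable_int mu) := @integrable_fubini_setX2 _ _ _ _ _ mu mu _ _ mI mI _ ik.
  by apply: (@measurable_funM _ _ _ _ (cst (a s))) => //; exact: msp.
(* The factor [a s * b y] leaves the inner integral only where the section in [x] is integrable,
   that is, for almost every [y]; hence an almost everywhere comparison of integrands. *)
- have := @ae_integrable_section2 _ _ _ _ _ mu mu _ _ mI mI _ ik.
  apply: filterS => y iy Iy; have {}iy := iy Iy; rewrite /G1 /=.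
  rewrite tensorE/= -RintegralZr// /Rintegral fineK.
    by apply: eq_integral => x _; rewrite mulrA.
  apply: (integrable_fin_num mI).
  have := integrable_EFinZ mI (a s * b y) iy.
  by apply: eq_integrable => // x _ /=; rewrite mulrC.
Qed.

Let mG2 : measurable_fun cell (fun z : mR * mR => G2 z.2).
Proof. by apply: measurable_snd_setX => //; exact: integrable_EFin_measurable iG2. Qed.

Let iG2c : (leb2 R).-integrable cell (EFin \o (fun z => G2 z.2)).
Proof. by apply: (integrable_bounded mC muCy mG2) => z _; exact: bG2. Qed.

Let integral_tensor (a b : R -> R) M : mu.-integrable I (EFin \o a) ->
  measurable_fun I b -> (forall x, I x -> `|b x| <= M) ->
  torus_int (fun z => a z.1 * b z.2) = imean a * imean b.
Proof.
move=> ia mb hM.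
have mk : measurable_fun (I `*` I) (fun z : mR * mR => b z.2).
  by apply: measurable_snd_setX.
have := @Rintegral_kernel1 _ _ mR mR R mu mu I I mI mI a (fun z => b z.2) M ia mk.
move=> /(_ _ muIy) e; rewrite /torus_int.
transitivity (\int[mu]_(x in I) (a x * imean b)); first by apply: e => z [_ ?]; exact: hM.
by rewrite RintegralZr.
Qed.

Let fbar := torus_int f.
Let W (z : R * R) : R := (f z - fbar) + (G1 z + G2 z.2).

Let iW : (leb2 R).-integrable cell (EFin \o W).
Proof.
apply: (integrable_EFinD mC); last exact: (integrable_EFinD mC).
by apply: (integrable_EFinB mC iF); exact: (integrable_EFin_cst mC).
Qed.

(** Split a b = (a - m(a)) b + m(a) (b - m(b)) + m(a) m(b), where m is the mean. Integrated against
    [f], the first two terms turn by duality into minus the contributions of [G1] and [G2]; the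
    third cancels that of [fbar], because the integral of [tensor a b] is m(a) m(b). *)
Let W_ortho (a b : R -> R) : SP a -> SP b -> torus_int (fun z => W z * tensor a b z) = 0.
Proof.
move=> sa sb.
have [A [sA A' AE]] := SP_primitive sa.
have [B [sB B' BE]] := SP_primitive sb.
pose a0 x := a x - imean a; pose b0 x := b x - imean b.
have s0 (c : R -> R) : SP c -> SP (fun x => c x - imean c).
  move=> [cc pc]; split; last by move=> x; rewrite pc.
  exact: (CinfB cc (Cinf_cst _)).
have ia : mu.-integrable I (EFin \o a).
  by apply: continuous_integrable_unit; case: sa => /Cinf_continuous.
have e1 : torus_int (fun z => f z * tensor a0 b z) = - torus_int (fun z => G1 z * tensor a b z).
  rewrite -(dual1 sa sb AE) -weak_tensor1//; apply: eq_Rintegral => z _.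
  by rewrite tensorE A'.
pose ca : R -> R := cst (imean a).
have sca : SP ca by exact: SP_cst.
have e2 : torus_int (fun z => f z * tensor ca b0 z) = - (imean a * imean (G2 \* b)).
  have -> : imean (G2 \* b) = torus_int (fun z => g2 z * B z.2) by rewrite (dual2 sb BE).
  rewrite [X in - (_ * X)]/torus_int -RintegralZl//.
    transitivity (- torus_int (fun z => g2 z * tensor ca B z)).
      rewrite -weak_tensor2//; apply: eq_Rintegral => z _.
      by rewrite tensorE B'.
    by congr (- _); apply: eq_Rintegral => z _; rewrite tensorE mulrCA.
  have := imt ig2 (SP_cst 1) sB; apply: eq_integrable => // z _ /=.
  by rewrite tensorE mul1r.
have [M hM] := SP_bounded sb.
pose N := \int[leb2 R]_(z in cell) `|g2 z|.
have mG2b : measurable_fun I (G2 \* b).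
  exact: (measurable_funM (integrable_EFin_measurable iG2) (msp sb)).
have bG2b x : I x -> `|(G2 \* b) x| <= N * M.
  by move=> Ix; rewrite normrM ler_pM ?bG2 ?hM.
have e3 : torus_int (fun z => G2 z.2 * tensor a b z) = imean a * imean (G2 \* b).
  rewrite -(@integral_tensor _ _ (N * M)) => //.
  by apply: eq_Rintegral => z _; rewrite tensorE/=; ring.
have e4 : torus_int (tensor a b) = imean a * imean b.
  by apply: (@integral_tensor _ _ M) => //; exact: msp.
have i1 := imt iF (s0 _ sa) sb.
have i2 := imt iF sca (s0 _ sb).
have i3 : (leb2 R).-integrable cell (EFin \o (fun z => (imean a * imean b) * f z)).
  exact: integrable_EFinZ.
have iT : (leb2 R).-integrable cell (EFin \o tensor a b).
  have := imt (integrable_EFin_cst mC 1 muCy) sa sb.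
  by apply: eq_integrable => // z _ /=; rewrite mul1r.
have i4 : (leb2 R).-integrable cell (EFin \o (fun z => (- fbar) * tensor a b z)).
  exact: integrable_EFinZ.
have i5 := imt iG1 sa sb.
have i6 := imt iG2c sa sb.
have -> : torus_int (fun z => W z * tensor a b z) =
  torus_int (fun z => f z * tensor a0 b z + (f z * tensor ca b0 z +
   ((imean a * imean b) * f z + ((- fbar) * tensor a b z + (G1 z * tensor a b z +
   G2 z.2 * tensor a b z))))).
  by apply: eq_Rintegral => z _; rewrite /W !tensorE /a0 /b0 /ca /cst; ring.
have i56 := integrable_EFinD mC i5 i6.
have i456 := integrable_EFinD mC i4 i56.
have i36 := integrable_EFinD mC i3 i456.
have i26 := integrable_EFinD mC i2 i36.
rewrite /torus_int in e1 e2 e3 e4 *.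
rewrite !RintegralD//.
rewrite !RintegralZl//.
rewrite e1 e2 e3 e4 -/(torus_int f) -/fbar; ring.
Qed.

Lemma poincare_ae : {ae leb2 R, forall z, cell z ->
  (((f z - torus_int f) ^+ 2)%:E <=
   2%:E * \int[mu]_(x in I) (g1 (x, z.2) ^+ 2)%:E +
   2%:E * \int[leb2 R]_(w in cell) (g2 w ^+ 2)%:E)%E}.
Proof.
have := cell_ae_eq0 iW W_ortho.
apply: (@filterS _ _ (ae_filter_ringOfSetsType (leb2 R))) => -[s y] W0 Cz.
have [Is Iy] := Cz.
(* The pointwise bound follows from (u + v)^2 <= 2 u^2 + 2 v^2, which is the origin of both factors
   2, and from the variance inequality with a kernel bounded by 1. *)
have {}W0 : f (s, y) - fbar = - (G1 (s, y) + G2 y).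
  by apply/eqP; rewrite -addr_eq0; apply/eqP; exact: W0.
rewrite -/fbar W0 sqrrN.
apply: (@le_trans _ _ (2%:E * (G1 (s, y) ^+ 2)%:E + 2%:E * (G2 y ^+ 2)%:E)%E).
  rewrite -!EFinM -EFinD lee_fin.
  have := sqr_ge0 (G1 (s, y) - G2 y); nra.
have mg1y : measurable_fun I (fun x => g1 (x, y)) by exact: (measurable_section2 mI mI Iy mg1).
apply: leeD; apply: lee_wpmul2l => //.
- apply: (@sqr_Rintegral_lee _ _ _ _ _ mI leb1_unit_itv) => //.
    apply: measurable_funM => //.
    apply: (@measurableT_comp _ _ _ _ _ _ (fun z : mR * mR => kern z.1 z.2) _
      (fun x : mR => (x, s))); first exact: measurable_kern.
    by apply: measurable_funTS; exact: measurable_fun_pair.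
  by move=> x Ix; rewrite normrM ler_piMr//; exact: kern_le1.
- apply: (@sqr_Rintegral_lee _ _ _ _ _ mC leb2_cell) => //.
    by apply: measurable_funM => //; exact: mkern2.
  by move=> [x y'] [Ix Iy']; rewrite normrM ler_piMr//; exact: kern_le1.
Qed.

Lemma poincare : (\int[leb2 R]_(z in cell) ((f z - torus_int f) ^+ 2)%:E <=
  2%:E * \int[leb2 R]_(z in cell) (g1 z ^+ 2)%:E +
  2%:E * \int[leb2 R]_(z in cell) (g2 z ^+ 2)%:E)%E.
Proof.
pose U (y : R) := (\int[mu]_(x in I) (g1 (x, y) ^+ 2)%:E)%E.
pose c := (\int[leb2 R]_(w in cell) (g2 w ^+ 2)%:E)%E.
have c0 : (0 <= c)%E by apply: integral_ge0 => z _; rewrite lee_fin sqr_ge0.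
have U0 y : (0 <= U y)%E by apply: integral_ge0 => z _; rewrite lee_fin sqr_ge0.
have mg12 : measurable_fun cell (fun z : mR * mR => (g1 z ^+ 2)%:E).
  by apply/measurable_EFinP; exact: measurable_funX.
have mU : measurable_fun I U.
  have := @measurable_fun_fubini_tonelli_G _ _ mR mR R mu
    ((fun z : mR * mR => (g1 z ^+ 2)%:E) \_ cell) => mG.
  have {}mG : measurable_fun setT (fubini_G mu ((fun z : mR * mR => (g1 z ^+ 2)%:E) \_ cell)).
    apply: mG; first exact/(measurable_restrictT _ mC).
    by move=> z; apply: erestrict_ge0 => w _; rewrite lee_fin sqr_ge0.
  apply: eq_measurable_fun (measurable_funTS mG) => y /set_mem Iy.
  rewrite /fubini_G /U [RHS]integral_mkcond; apply: eq_integral => x _.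
  by rewrite restrict_setX !patchE (mem_set Iy).
have mUc : measurable_fun cell (fun z : mR * mR => U z.2) by exact: measurable_snd_setX.
apply: (@le_trans _ _ (\int[leb2 R]_(z in cell) (2%:E * U z.2 + 2%:E * c))%E).
  apply: (@ae_ge0_le_integral _ _ _ _ _ mC _ (fun z => 2%:E * U z.2 + 2%:E * c)%E
    _ _ _ _ poincare_ae).
  - by move=> z _; rewrite lee_fin sqr_ge0.
  - by apply/measurable_EFinP; apply: measurable_funX; exact: measurable_funB.
  - by move=> z _; apply: adde_ge0; apply: mule_ge0; rewrite // lee_fin.
  - apply: emeasurable_funD => //; exact: measurable_funeM.
rewrite ge0_integralD//; last 3 first.
- by move=> z _; rewrite mule_ge0.
- exact: measurable_funeM.
- by move=> z _; rewrite mule_ge0.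
apply: leeD.
  rewrite ge0_integralZl//; apply: lee_wpmul2l => //.
  (* The bound is constant along the first variable, so averaging over the cell leaves the integral
     in [y], which Tonelli turns into the full integral of g1^2. *)
  have -> : (\int[leb2 R]_(z in cell) U z.2 = \int[mu]_(y in I) U y)%E.
    rewrite (@ge0_integral_setX1 _ _ _ _ _ mu mu)//.
    transitivity ((\int[mu]_(y in I) U y) * mu I)%E.
      exact: (integral_cst mu mI (\int[mu]_(y in I) U y)%E).
    by rewrite leb1_unit_itv mule1.
  rewrite [leRHS](@ge0_integral_setX2 _ _ _ _ _ mu mu)//.
  by move=> z _; rewrite lee_fin sqr_ge0.
have -> : (\int[leb2 R]_(z in cell) (2%:E * c) = 2%:E * c * leb2 R cell)%E.
  exact: (integral_cst (leb2 R) mC (2%:E * c)%E).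
by rewrite leb2_cell mule1.
Qed.

End poincare.

(** * Conservation of momentum *)

Section du_bois_reymond.
Context {R : realType}.
Notation mu := (@lebesgue_measure R).

(** A primitive of a one-sided approximate Dirac mass: its derivative is nonnegative, lives on
    [t0, t0 + e] and has integral 1. The argument is written as an affine function in the shape that
    [Cinf_affine] expects. *)
Definition ramp (e t0 t : R) : R := step (e^-1 * t + (- (e^-1 * t0))).

Lemma rampE e t0 t : ramp e t0 t = step (e^-1 * (t - t0)).
Proof. by rewrite /ramp mulrBr. Qed.

Lemma Cinf_ramp e t0 : Cinf (ramp e t0).
Proof. exact/Cinf_affine/Cinf_step. Qed.

Lemma ramp_eq0 e t0 t : 0 < e -> t <= t0 -> ramp e t0 t = 0.
Proof.
move=> e0 t0t; rewrite rampE step_le0// mulr_ge0_le0 ?subr_le0//.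
by rewrite invr_ge0 ltW.
Qed.

Lemma ramp_eq1 e t0 t : 0 < e -> t0 + e <= t -> ramp e t0 t = 1.
Proof.
move=> e0 t0t; rewrite rampE step_ge1// mulrC ler_pdivlMr// mul1r.
by rewrite lerBrDl.
Qed.

Lemma ramp_derive_ge0 e t0 t : 0 < e -> 0 <= (ramp e t0)^`()%classic t.
Proof.
move=> e0.
have nd : {homo ramp e t0 : x y / x <= y}.
  move=> x y xy; rewrite !rampE step_nd// ler_pM2l ?invr_gt0//.
  by rewrite lerD2r.
have [d _] := Cinf_is_derive t (Cinf_ramp e t0).
rewrite derive1E /derive; apply: limr_ge; first exact: d.
near=> h; rewrite /GRing.scale/= mulr1.
have [h0|h0|->] := ltgtP h 0.
- apply: mulr_le0; first by rewrite invr_le0 ltW.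
  by rewrite subr_le0 nd// gerDr ltW.
- apply: mulr_ge0; first by rewrite invr_ge0 ltW.
  by rewrite subr_ge0 nd// lerDr ltW.
- by rewrite invr0 mul0r.
Unshelve. all: by end_near. Qed.

Lemma ramp_derive_eq0 e t0 t : 0 < e -> ~~ (t0 <= t <= t0 + e) ->
  (ramp e t0)^`()%classic t = 0.
Proof.
move=> e0; rewrite negb_and -!ltNge => /orP tt.
have h (c : R) : (\forall y \near t, cst c y = ramp e t0 y) ->
    (ramp e t0)^`()%classic t = 0.
  by move=> /near_eq_derive hc; rewrite derive1E -hc derive_cst.
case: tt => tt; [apply: (h 0)|apply: (h 1)]; near=> y.
- rewrite ramp_eq0//; apply/ltW; near: y; exact: lt_nbhsl.
- rewrite ramp_eq1//; apply/ltW; near: y; exact: lt_nbhsr.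
Unshelve. all: by end_near. Qed.

Lemma integral_ramp_derive e t0 u w : 0 < e -> u <= t0 -> t0 + e <= w ->
  \int[mu]_(t in `[u, w]) (ramp e t0)^`()%classic t = 1.
Proof.
move=> e0 ut tw; have cr := Cinf_ramp e t0.
have uw : u < w by lra.
rewrite /Rintegral (@continuous_FTC2 _ _ (ramp e t0))//.
- by rewrite /= ramp_eq1// ramp_eq0// subr0.
- exact/continuous_subspaceT/Cinf_continuous/Cinf_derive1.
- split=> [x _||].
  + by case: (Cinf_is_derive x cr).
  + by apply: cvg_at_right_filter; exact: Cinf_continuous.
  + by apply: cvg_at_left_filter; exact: Cinf_continuous.
Qed.

(** The derivative of the ramp is a probability density, so the integral is an average of values of
    [M] on [t0, t0 + e]. *)
Lemma integral_ramp_near (M : R -> R) e d t0 u w : 0 < e -> u <= t0 -> t0 + e <= w ->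
  {within `[u, w], continuous M} ->
  (forall t, t0 <= t <= t0 + e -> `|M t - M t0| <= d) ->
  `|\int[mu]_(t in `[u, w]) (M t * (ramp e t0)^`()%classic t) - M t0| <= d.
Proof.
move=> e0 ut tw cM hd; set r := (ramp e t0)^`()%classic.
have cr : continuous r by exact/Cinf_continuous/Cinf_derive1/Cinf_ramp.
have cmp (g : R -> R) : {within `[u, w], continuous g} -> mu.-integrable `[u, w] (EFin \o g).
  by move=> cg; apply: continuous_compact_integrable => //; exact: segment_compact.
have crw : {within `[u, w], continuous r} by exact: continuous_subspaceT.
have ir := cmp _ crw.
have iMr : mu.-integrable `[u, w] (EFin \o (fun t => M t * r t)).
  by apply: cmp => x; apply: cvgM; [exact: cM|exact: crw].
have e1 : \int[mu]_(t in `[u, w]) r t = 1 by exact: integral_ramp_derive.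
have -> : \int[mu]_(t in `[u, w]) (M t * r t) - M t0 =
    \int[mu]_(t in `[u, w]) (M t * r t - M t0 * r t).
  rewrite RintegralB//; last exact: integrable_EFinZ.
  by rewrite RintegralZl// e1 mulr1.
have mK : measurable (`[u, w]%classic : set (measurableTypeR R)) by exact: measurable_itv.
have iB := integrable_EFinB mK iMr (integrable_EFinZ mK (M t0) ir).
apply: le_trans (le_normr_Rintegral _ iB) _ => //.
rewrite -[leRHS]mulr1 -e1 -RintegralZl//.
apply: le_Rintegral => //.
- exact: integrable_norm.
- exact: integrable_EFinZ.
move=> t _; rewrite -mulrBl normrM [X in _ * X]ger0_norm ?ramp_derive_ge0//.
have [tt|tt] := boolP (t0 <= t <= t0 + e).
  by rewrite ler_wpM2r ?ramp_derive_ge0// hd.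
by rewrite /r ramp_derive_eq0// !mulr0.
Qed.

(** Test with the difference of the ramps at [t1] and [t2]: it is compactly supported, and its
    derivative approximates the difference of the Dirac masses at [t1] and [t2]. Ramps rising to the
    right keep the support in [t1, t2 + e], away from 0. *)
Lemma const_of_test (M : R -> R) :
  (forall t, 0 < t -> {for t, continuous M}) ->
  (forall s T psi, 0 < s -> s < T -> Cinf psi ->
    (forall t, ~~ (s <= t <= T) -> psi t = 0) ->
    \int[mu]_(t in `[s, T]) (M t * psi^`()%classic t) = 0) ->
  forall t1 t2, 0 < t1 -> t1 < t2 -> M t1 = M t2.
Proof.
move=> cM h t1 t2 t10 t12.
have t20 := lt_trans t10 t12.
apply/eqP; rewrite -subr_eq0 -normr_le0; apply/ler_addgt0Pl => d d0; rewrite addr0.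
have [e e0 he] : exists2 e, 0 < e & forall t0, (t0 = t1) \/ (t0 = t2) ->
    forall t, t0 <= t <= t0 + e -> `|M t - M t0| <= d / 2.
  have d20 : 0 < d / 2 by rewrite divr_gt0.
  have hh t0 : 0 < t0 -> exists2 e, 0 < e &
      forall t, t0 <= t <= t0 + e -> `|M t - M t0| <= d / 2.
    move=> t00; have /cvgrPdist_le /(_ _ d20) := cM _ t00.
    move=> /nbhs_ballP[e /= e0 he]; exists (e / 2); first by rewrite divr_gt0.
    move=> t /andP[tt te]; rewrite distrC; apply: he; rewrite /ball/= ler0_norm; lra.
  have [a a0 ha] := hh _ t10; have [b b0 hb] := hh _ t20.
  exists (Num.min a b); first by rewrite lt_min a0.
  move=> t0 [->|->] t /andP[tt te]; [apply: ha|apply: hb]; rewrite tt/= (le_trans te)//;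
    by rewrite lerD2l ge_min lexx ?orbT.
pose psi := ramp e t1 \- ramp e t2.
have cpsi : Cinf psi by apply: CinfB; exact: Cinf_ramp.
have t2e : t1 < t2 + e by lra.
have psi0 t : ~~ (t1 <= t <= t2 + e) -> psi t = 0.
  rewrite negb_and -!ltNge /psi/= => /orP[tt|tt].
    by rewrite !ramp_eq0 ?subrr//; lra.
  by rewrite !ramp_eq1 ?subrr//; lra.
have cMw : {within `[t1, t2 + e], continuous M}.
  apply: continuous_in_subspaceT => x; rewrite inE /= in_itv/= => /andP[tx _].
  by apply: cM; exact: lt_le_trans tx.
have := h _ _ _ t10 t2e cpsi psi0.
have dpsi t : psi^`()%classic t = (ramp e t1)^`()%classic t - (ramp e t2)^`()%classic t.
  rewrite [LHS]derive1E; apply: derive_val.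
  by apply: is_deriveB; exact/Cinf_is_derive/Cinf_ramp.
under eq_Rintegral do rewrite dpsi mulrBr.
have im t0 : mu.-integrable `[t1, t2 + e] (EFin \o (fun t => M t * (ramp e t0)^`()%classic t)).
  apply: continuous_compact_integrable; first exact: segment_compact.
  move=> x; apply: cvgM; first exact: cMw.
  exact/continuous_subspaceT/Cinf_continuous/Cinf_derive1/Cinf_ramp.
rewrite RintegralB//.
have l1 := @integral_ramp_near M e (d / 2) t1 t1 (t2 + e) e0 (lexx _) _ cMw (he _ (or_introl erefl)).
have l2 := @integral_ramp_near M e (d / 2) t2 t1 (t2 + e) e0 (ltW t12) (lexx _) cMw (he _ (or_intror erefl)).
have {}l1 := l1 ltac:(lra).
have key (X Y : R) : `|X - M t1| <= d / 2 -> `|Y - M t2| <= d / 2 -> X - Y = 0 ->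
    `|M t1 - M t2| <= d.
  by rewrite !ler_norml => /andP[? ?] /andP[? ?] ?; apply/andP; split; lra.
exact: key l1 l2.
Qed.

End du_bois_reymond.

(** * Squares of nonnegative extended reals *)

Section ereal_squares.
Context {R : realType}.
Local Open Scope ereal_scope.
Implicit Types x y : \bar R.

Lemma sqre_half x : 0 <= x -> (x `^ 2^-1) `^ 2 = x.
Proof. by move=> x0; rewrite -poweRrM mulVf ?pnatr_eq0// poweRe1. Qed.

Lemma half_sqre x : 0 <= x -> (x `^ 2) `^ 2^-1 = x.
Proof. by move=> x0; rewrite -poweRrM mulfV ?pnatr_eq0// poweRe1. Qed.

Lemma le_sqre x y : 0 <= x -> x <= y -> x `^ 2 <= y `^ 2.
Proof.
move=> x0 xy; apply: gt0_ler_poweR => //; rewrite in_itv/= leey ?andbT//.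
exact: le_trans xy.
Qed.

Lemma le_sqre_EFin x (e : R) : 0 <= x -> (0 <= e)%R ->
  (x `^ 2 <= (e ^+ 2)%:E) = (x <= e%:E).
Proof.
move=> x0 e0; have e2 : (e ^+ 2)%:E = e%:E `^ 2 by rewrite poweR_EFin powR_mulrn.
apply/idP/idP => [h|h]; last by rewrite e2 le_sqre.
rewrite -[leLHS]half_sqre// -[leRHS]half_sqre ?lee_fin// -e2.
apply: gt0_ler_poweR h; rewrite ?invr_ge0//.
  by rewrite in_itv/= poweR_ge0 leey.
by rewrite in_itv/= lee_fin sqr_ge0 leey.
Qed.

Lemma ge0_cvge0P (T : Type) (F : set_system T) (FF : Filter F) (X : T -> \bar R) :
  (forall t, 0 <= X t) ->
  (X t @[t --> F] --> 0) <->
  (forall e : R, (0 < e)%R -> \forall t \near F, X t <= e%:E).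
Proof.
move=> X0; split=> [h e e0|h].
  have /fine_cvgP[fX /cvgrPdist_le /(_ _ e0)] := h.
  apply: filterS2 fX => t fX; rewrite sub0r normrN => Xe.
  by rewrite -(fineK fX) lee_fin (le_trans (ler_norm _)).
apply/fine_cvgP; split.
  apply: filterS (h _ ltr01) => t Xt; rewrite ge0_fin_numE//.
  by rewrite (le_lt_trans Xt) ?ltry.
apply/cvgrPdist_le => e e0; apply: filterS (h _ e0) => t Xt.
rewrite sub0r normrN /= ger0_norm ?fine_ge0// -lee_fin fineK//.
by rewrite ge0_fin_numE// (le_lt_trans Xt) ?ltry.
Qed.

(** The norms in play are square roots of sums of squares; convergence to 0 is checked on squares,
    where components and derivatives separate. *)
Lemma ge0_cvge0_sqr (T : Type) (F : set_system T) (FF : Filter F) (X : T -> \bar R) :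
  (forall t, 0 <= X t) ->
  (X t @[t --> F] --> 0) <->
  (forall e : R, (0 < e)%R -> \forall t \near F, X t `^ 2 <= e%:E).
Proof.
move=> X0; rewrite ge0_cvge0P//; split=> h e e0.
  have s0 : (0 < Num.sqrt e)%R by rewrite sqrtr_gt0.
  apply: filterS (h _ s0) => t Xt.
  by rewrite -(sqr_sqrtr (ltW e0)) le_sqre_EFin// ltW.
have e20 : (0 < e ^+ 2)%R by rewrite exprn_gt0.
by apply: filterS (h _ e20) => t; rewrite le_sqre_EFin// ltW.
Qed.

End ereal_squares.

(** * Sobolev norms of exponent two as sums of squares *)

Section sobolev_norms.
Context {R : realType}.
Notation mR := (measurableTypeR R).
Local Open Scope ereal_scope.

Lemma Lr_norm_ge0 (r : \bar R) (f : R * R -> R) : 0 <= Lr_norm r f.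
Proof. by rewrite /Lr_norm; case: asboolP => // _; exact: Lnorm_ge0. Qed.

Lemma Lr_norm2E (f : R * R -> R) : measurable_fun cell f ->
  Lr_norm 2%:E f `^ 2 = \int[leb2 R]_(z in cell) (f z ^+ 2)%:E.
Proof.
move=> mf; rewrite /Lr_norm asboolT// poweR_Lnorm ?pnatr_eq0//.
rewrite [RHS]integral_mkcond; apply: eq_integral => z _ /=.
rewrite !patchE; case: ifPn => _.
  by rewrite powR_mulrn// real_normK ?num_real.
by rewrite normr0 powR0 ?pnatr_eq0.
Qed.

(** Measurability is part of finiteness, since [Lr_norm] is +oo by convention on nonmeasurable
    functions. *)
Lemma Lr_norm2_L2on (f : R * R -> R) : Lr_norm 2%:E f < +oo ->
  measurable_fun cell f /\ L2on (leb2 R) cell f.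
Proof.
move=> fy; have mf : measurable_fun cell f.
  by apply: contrapT => nmf; move: fy; rewrite /Lr_norm asboolF.
split=> //; split=> //; apply/integrableP; split.
  by apply/measurable_EFinP; exact: measurable_funX.
under eq_integral do rewrite gee0_abs ?lee_fin ?sqr_ge0//.
by rewrite -Lr_norm2E// poweR_lty.
Qed.

Lemma Lr_norm2_Rint (f : R * R -> R) : Lr_norm 2%:E f < +oo ->
  Lr_norm 2%:E f `^ 2 = (\int[leb2 R]_(z in cell) f z ^+ 2)%:E.
Proof.
move=> /Lr_norm2_L2on[mf [_ f2]]; rewrite Lr_norm2E// fineK//.
exact: (integrable_fin_num measurable_cell f2).
Qed.

Lemma vect_norm2E (N : (R * R -> R) -> \bar R) u :
  vect_norm 2 N u `^ 2 = \sum_(i < 2) N (u i) `^ 2.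
Proof. by rewrite /vect_norm sqre_half// sume_ge0// => i _; exact: poweR_ge0. Qed.

Lemma le_vect_norm2 (N : (R * R -> R) -> \bar R) u i :
  N (u i) `^ 2 <= vect_norm 2 N u `^ 2.
Proof.
rewrite vect_norm2E (bigD1 i)//= leeDl// sume_ge0// => j _; exact: poweR_ge0.
Qed.

Lemma grad_L2_norm2E (u : 'I_2 -> R * R -> R) : grad_L2_norm u `^ 2 =
  \sum_(i < 2) (partial_norm 2%:E (1%N, 0%N) (u i) `^ 2 +
                partial_norm 2%:E (0%N, 1%N) (u i) `^ 2).
Proof.
rewrite /grad_L2_norm sqre_half// sume_ge0// => i _.
by rewrite adde_ge0// poweR_ge0.
Qed.

Let sobolev_sqr (f : R * R -> R) : sobolev_norm 1 2 f `^ 2 =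
  \sum_(al : 'I_2 * 'I_2 | (al.1 + al.2 <= 1)%N)
    partial_norm 2%:E (al.1 : nat, al.2 : nat) f `^ 2.
Proof. by rewrite /sobolev_norm sqre_half// sume_ge0// => i _; exact: poweR_ge0. Qed.

Lemma le_sobolev_norm12 (f : R * R -> R) (al : 'I_2 * 'I_2) : (al.1 + al.2 <= 1)%N ->
  partial_norm 2%:E (al.1 : nat, al.2 : nat) f `^ 2 <= sobolev_norm 1 2 f `^ 2.
Proof.
move=> al1; rewrite sobolev_sqr (bigD1 al)//= leeDl// sume_ge0// => i _.
exact: poweR_ge0.
Qed.

(** The factor 4 is the cardinal of the index type of pairs, a crude bound for the three pairs of
    order at most one. *)
Lemma sobolev_norm12_le (f : R * R -> R) (e : R) : (0 <= e)%R ->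
  (forall al, (al.1 + al.2 <= 1)%N -> partial_norm 2%:E al f `^ 2 <= e%:E) ->
  sobolev_norm 1 2 f `^ 2 <= (4 * e)%:E.
Proof.
move=> e0 h; rewrite sobolev_sqr.
apply: (@le_trans _ _ (\sum_(al : 'I_2 * 'I_2) e%:E)).
  rewrite [leLHS]big_mkcond/=; apply: lee_sum => al _.
  case: ifPn => [al1|_]; last by rewrite lee_fin.
  exact: (h (al.1 : nat, al.2 : nat)).
rewrite sumEFin sumr_const card_prod !card_ord lee_fin.
by rewrite mulr_natl.
Qed.

(** The order-zero term is +oo without a weak derivative of order (0, 0). Such a derivative carries
    the integrability of [f], which is how the initial data are seen to be measurable. *)
Lemma sobolev_norm_exists (k : nat) (r : R) (f : R * R -> R) : (0 < r)%R ->
  sobolev_norm k r f < +oo -> exists g, weak_partial (0%N, 0%N) f g.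
Proof.
move=> r0 fy; apply: contrapT => nf.
have p0 : partial_norm r%:E (0%N, 0%N) f = +oo by rewrite /partial_norm asboolF.
move: fy; rewrite /sobolev_norm (bigD1 (ord0, ord0))//= p0.
rewrite poweRyr ?gt_eqF// addye; last first.
  rewrite gt_eqF// (@lt_le_trans _ _ 0)// sume_ge0// => i _; exact: poweR_ge0.
by rewrite poweRyr// invr_eq0 gt_eqF.
Qed.

End sobolev_norms.

(** * Distributional derivatives tested against functions of time alone *)

Section space_time_integrals.
Context {R : realType}.
Notation mR := (measurableTypeR R).
Notation plane := (R * R)%type.
Notation halfspace := (`]0%R, +oo[ `*` cell : set (mR * (mR * mR))).

Lemma measurable_halfspace : measurable (halfspace).
Proof. by apply: measurableX; [exact: measurable_itv|exact: measurable_cell]. Qed.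

Variables (s T : R) (psi : R -> R).
Hypotheses (s0 : 0 < s) (sT : s < T) (cpsi : Cinf psi)
  (psi0 : forall t, ~~ (s <= t <= T) -> psi t = 0).

Let slab := (`[s, T] `*` cell : set (mR * (mR * mR))).

Let mslab : measurable slab.
Proof. by apply: measurableX; [exact: measurable_itv|exact: measurable_cell]. Qed.

Let psi_bounded : exists M, forall t, `|psi t| <= M.
Proof.
have cn : {within `[s, T], continuous (fun x => `|psi x|)}.
  apply: continuous_subspaceT => x.
  by apply: continuous_comp; [exact: Cinf_continuous|exact: norm_continuous].
have [c _ hc] := EVT_max (ltW sT) cn; exists `|psi c| => t.
have [st|st] := boolP (s <= t <= T); first by apply: hc; rewrite in_itv.
by rewrite psi0// normr0.
Qed.

(** The support of [psi] lies in [s, T] with s > 0, so integrals over all positive times live on a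
    slab, where local integrability is integrability. *)
Lemma restrict_halfspace (h : R -> plane -> R) :
  (fun z => h z.1 z.2 * psi z.1) \_ halfspace = (fun z => h z.1 z.2 * psi z.1) \_ slab.
Proof.
apply/funext => -[t x]; rewrite !patchE !in_setX /=.
have [st|st] := boolP (s <= t <= T); last first.
  by rewrite psi0// mulr0; case: ifP; case: ifP.
rewrite [t \in `[s, T]%classic]mem_set ?[t \in `]0, +oo[%classic]mem_set//.
by rewrite /= in_itv/= andbT; case/andP: st => /(lt_le_trans s0).
Qed.

Let integrable_slab (h : R -> plane -> R) : st_loc_integrable h ->
  (leb3 R).-integrable slab (EFin \o (fun z => h z.1 z.2 * psi z.1)).
Proof.
move=> /(_ _ _ s0 sT) ih; have [M hM] := psi_bounded.
apply: (integrable_EFinM mslab ih _ (c := M)) => //.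
apply: measurable_funTS; apply: (@measurableT_comp _ _ _ _ _ _ psi).
  exact: Cinf_measurable.
exact: measurable_fst.
Qed.

Lemma st_integrable_test (h : R -> plane -> R) : st_loc_integrable h ->
  (leb3 R).-integrable halfspace (EFin \o (fun z => h z.1 z.2 * psi z.1)).
Proof.
move=> /integrable_slab ih; apply/(integrable_mkcond _ measurable_halfspace).
rewrite restrict_EFin restrict_halfspace -restrict_EFin.
exact/(integrable_mkcond _ mslab).
Qed.

Lemma st_int_test (h : R -> plane -> R) : st_loc_integrable h ->
  (forall t, s <= t <= T -> (leb2 R).-integrable cell (EFin \o h t)) ->
  st_int (fun z => h z.1 z.2 * psi z.1) =
  \int[leb1 R]_(t in `[s, T]) (torus_int (h t) * psi t).
Proof.
move=> lh ih; rewrite /st_int Rintegral_mkcond restrict_halfspace -Rintegral_mkcond.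
rewrite /Rintegral (@integral_setX1 _ _ mR (mR * mR)%type R (leb1 R) (leb2 R)).
- congr fine; apply: eq_integral => t /set_mem; rewrite /= in_itv/= => tI.
  have it := ih _ tI.
  rewrite -RintegralZr//; last exact: measurable_cell.
  rewrite fineK//; apply: (integrable_fin_num measurable_cell).
  have := integrable_EFinZ measurable_cell (psi t) it.
  by apply: eq_integrable => [|x _ /=]; [exact: measurable_cell|rewrite mulrC].
- exact: measurable_itv.
- exact: measurable_cell.
- exact: integrable_slab.
Qed.

Lemma st_test_time : st_test (psi \o fst : R * plane -> R).
Proof.
split.
- exact: smooth_fst.
- by move=> t x y.
- by exists s, T; split=> // t x; exact: psi0.
Qed.

Lemma derive_test_dx j (z : R * plane) : 'D_(dx j) (psi \o fst : R * plane -> R) z = 0.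
Proof. by rewrite diff_fst_comp//= mul0r. Qed.

Lemma derive_test_dt (z : R * plane) :
  'D_dt (psi \o fst : R * plane -> R) z = psi^`()%classic z.1.
Proof. by rewrite diff_fst_comp//= mul1r. Qed.

Lemma wDP (d : seq (R * plane)) (h : R -> plane -> R) : regular d h ->
  st_weak_derive d h (wD d h).
Proof. by move=> [g hg]; exact: (getPex (P := [set g | st_weak_derive d h g]) (ex_intro _ g hg)). Qed.

(** The spatial derivative is transferred to [psi \o fst], which does not depend on position. *)
Lemma st_int_wD_dx j (h : R -> plane -> R) : regular [:: dx j] h ->
  st_int (fun z => wD [:: dx j] h z.1 z.2 * psi z.1) = 0.
Proof.
move=> /wDP[_ _ /(_ _ st_test_time)]; rewrite /iter_derive/= => e.
have : st_int (fun z => h z.1 z.2 * 'D_(dx j) (psi \o fst) z) = 0.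
  rewrite /st_int (_ : (fun z => _) = cst 0) ?Rintegral_cst ?mul0r//.
    exact: measurable_halfspace.
  by apply/funext => z; rewrite derive_test_dx mulr0.
by rewrite e expr1 mulN1r => /eqP; rewrite oppr_eq0 => /eqP.
Qed.

Lemma st_int_wD_dxdx j (h : R -> plane -> R) : regular [:: dx j; dx j] h ->
  st_int (fun z => wD [:: dx j; dx j] h z.1 z.2 * psi z.1) = 0.
Proof.
move=> /wDP[_ _ /(_ _ st_test_time)]; rewrite /iter_derive/= => e.
have : st_int (fun z => h z.1 z.2 * 'D_(dx j) ('D_(dx j) (psi \o fst)) z) = 0.
  rewrite /st_int (_ : (fun z => _) = cst 0) ?Rintegral_cst ?mul0r//.
    exact: measurable_halfspace.
  apply/funext => z; rewrite (_ : 'D_(dx j) (psi \o fst) = cst 0).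
    by rewrite derive_cst mulr0.
  by apply/funext => w; rewrite derive_test_dx.
by rewrite e sqrrN expr1n mul1r.
Qed.

Lemma st_int_wD_dt (h : R -> plane -> R) : regular [:: dt] h ->
  st_int (fun z => h z.1 z.2 * psi^`()%classic z.1) =
  - st_int (fun z => wD [:: dt] h z.1 z.2 * psi z.1).
Proof.
move=> /wDP[_ _ /(_ _ st_test_time)]; rewrite /iter_derive/= expr1 mulN1r => <-.
by congr st_int; apply/funext => z; rewrite derive_test_dt.
Qed.

Lemma regular_loc_integrable d (h : R -> plane -> R) : regular d h ->
  st_loc_integrable h /\ st_loc_integrable (wD d h).
Proof. by move=> /wDP[]. Qed.

End space_time_integrals.

(** * The total momentum is constant in time *)

Section momentum_conservation.
Context {R : realType}.
Notation mR := (measurableTypeR R).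
Notation plane := (R * R)%type.
Notation halfspace := (`]0%R, +oo[ `*` cell : set (mR * (mR * mR))).

Lemma derive1_eq0_off_support (s T : R) (psi : R -> R) :
  (forall t, ~~ (s <= t <= T) -> psi t = 0) ->
  forall t, ~~ (s <= t <= T) -> psi^`()%classic t = 0.
Proof.
move=> psi0 t; rewrite negb_and -!ltNge => tt.
suff /near_eq_derive h : \forall y \near t, cst 0 y = psi y.
  by rewrite derive1E -h derive_cst.
case/orP: tt => tt; near=> y; rewrite psi0// negb_and -!ltNge; apply/orP.
- by left; near: y; exact: lt_nbhsl.
- by right; near: y; exact: lt_nbhsr.
Unshelve. all: by end_near. Qed.

Variables (mu a b beta gamma : R) (rho : R -> plane -> R) (v : R -> 'I_2 -> plane -> R).
Hypotheses (hreg : derivatives_regular mu a b beta gamma rho v)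
  (hmom : momentum_equation mu a b beta gamma rho v)
  (hcont : forall T, 0 < T ->
     cont_in_time T (vect_norm 2 (Lr_norm 2%:E)) (momentum rho v)).
Variable i : 'I_2.

Lemma momentum_weak_eq0 (s T : R) (psi : R -> R) : 0 < s -> s < T -> Cinf psi ->
  (forall t, ~~ (s <= t <= T) -> psi t = 0) ->
  st_int (fun z => wD [:: dt] (component (momentum rho v) i) z.1 z.2 * psi z.1) = 0.
Proof.
move=> s0 sT cpsi psi0.
case: hreg => _ _ /(_ i)[rA _] rFL /(_ i)[rP rB].
pose A := wD [:: dt] (component (momentum rho v) i).
pose F j := wD [:: dx j] (mom_flux rho v i j).
pose P := wD [:: dx i] (press a gamma rho).
pose L j := wD [:: dx j; dx j] (component v i).
pose B := wD [:: dx i] (bulk mu b beta rho v).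
have iT h := @st_integrable_test _ s T psi s0 sT cpsi psi0 h.
have iA : (leb3 R).-integrable halfspace (EFin \o (fun z => A z.1 z.2 * psi z.1)) :=
  iT _ (regular_loc_integrable rA).2.
have iF j : (leb3 R).-integrable halfspace (EFin \o (fun z => F j z.1 z.2 * psi z.1)).
  by apply: iT; case: (rFL i j) => /regular_loc_integrable[].
have iP : (leb3 R).-integrable halfspace (EFin \o (fun z => P z.1 z.2 * psi z.1)) :=
  iT _ (regular_loc_integrable rP).2.
have iL j : (leb3 R).-integrable halfspace (EFin \o (fun z => L j z.1 z.2 * psi z.1)).
  by apply: iT; case: (rFL i j) => _ _ /regular_loc_integrable[].
have iB : (leb3 R).-integrable halfspace (EFin \o (fun z => B z.1 z.2 * psi z.1)) :=
  iT _ (regular_loc_integrable rB).2.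
have zF j : st_int (fun z => F j z.1 z.2 * psi z.1) = 0.
  by apply: (st_int_wD_dx s0 sT cpsi psi0); case: (rFL i j).
have zP : st_int (fun z => P z.1 z.2 * psi z.1) = 0.
  exact: (st_int_wD_dx s0 sT cpsi psi0).
have zL j : st_int (fun z => L j z.1 z.2 * psi z.1) = 0.
  by apply: (st_int_wD_dxdx s0 sT cpsi psi0); case: (rFL i j).
have zB : st_int (fun z => B z.1 z.2 * psi z.1) = 0.
  exact: (st_int_wD_dx s0 sT cpsi psi0).
have hm : st_ae (fun t x => A t x + \sum_(j < 2) F j t x + P t x =
  mu * (\sum_(j < 2) L j t x) + B t x) := hmom i.
rewrite -/A; clearbody A F P L B.
have mH := measurable_halfspace (R := R).
pose j0 : 'I_2 := ord0; pose j1 : 'I_2 := lift ord0 ord0.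
have i1 := integrable_EFinD mH (iL j0) (iL j1).
have i2 := integrable_EFinD mH (integrable_EFinZ mH mu i1) iB.
have i3 := integrable_EFinD mH (integrable_EFinD mH (iF j0) (iF j1)) iP.
have i4 := integrable_EFinB mH i2 i3.
have sum2 (X : 'I_2 -> R) : \sum_(j < 2) X j = X j0 + X j1.
  by rewrite big_ord_recl big_ord1.
(* The equation solved for the time derivative and multiplied by the test value [p]; every term on
   the right is a spatial derivative and integrates to zero. *)
have key Az F0 F1 Pz L0 L1 Bz p : Az + (F0 + F1) + Pz = mu * (L0 + L1) + Bz ->
    Az * p = mu * (L0 * p + L1 * p) + Bz * p - (F0 * p + F1 * p + Pz * p).
  move=> e; have -> : Az = mu * (L0 + L1) + Bz - (F0 + F1 + Pz) by rewrite -e; ring.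
  ring.
transitivity (st_int (fun z =>
    (mu * (L j0 z.1 z.2 * psi z.1 + L j1 z.1 z.2 * psi z.1) + B z.1 z.2 * psi z.1) -
    (F j0 z.1 z.2 * psi z.1 + F j1 z.1 z.2 * psi z.1 + P z.1 z.2 * psi z.1))).
  rewrite /st_int /Rintegral; congr fine; apply: ae_eq_integral => //.
  - exact: measurable_int iA.
  - exact: measurable_int i4.
  - have := hm.
    apply: (@filterS _ _ (ae_filter_ringOfSetsType (leb3 R))) => z /[apply].
    move=> e; congr EFin; apply: key.
    by rewrite !sum2 in e.
rewrite /st_int in zF zP zL zB *.
rewrite RintegralB// RintegralD//; last exact: integrable_EFinZ.
rewrite RintegralZl// !RintegralD//; last exact: integrable_EFinD.
by rewrite !zF zP !zL zB; ring.
Qed.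

Let M (t : R) := torus_int (momentum rho v t i).

Lemma momentum_Lr_lty t : 0 <= t -> (Lr_norm 2%:E (momentum rho v t i) < +oo)%E.
Proof.
move=> t0; have t1 : 0 < t + 1 by rewrite ltr_wpDl.
have [|+ _] := hcont t1 (t := t); first by rewrite t0 lerDl ler01.
move=> /(poweR_lty 2)/(le_lt_trans (le_vect_norm2 _ _ i)).
by apply: lty_poweRy; rewrite pnatr_eq0.
Qed.

Lemma momentum_integrable t : 0 <= t ->
  (leb2 R).-integrable cell (EFin \o momentum rho v t i).
Proof.
move=> /momentum_Lr_lty/Lr_norm2_L2on[_].
exact: (L2on_integrable measurable_cell leb2_cell).
Qed.

(** On a cell of mass 1, (M s - M t)^2 is at most the squared L^2 distance of the momenta at times
    [s] and [t]. *)
Lemma momentum_cont (T t : R) : 0 < T -> 0 <= t <= T ->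
  M s @[s --> within `[0, T] (nbhs t)] --> M t.
Proof.
move=> T0 tT; have t0 : 0 <= t by case/andP: tT.
have [_] := hcont T0 tT; rewrite ge0_cvge0_sqr; last by move=> s; exact: poweR_ge0.
move=> h; apply/cvgrPdist_le => e e0.
have e20 : 0 < e ^+ 2 by rewrite exprn_gt0.
have := h _ e20; rewrite !near_withinE; apply: filterS => s hs sI.
have {}hs := le_trans (le_vect_norm2 _ _ i) (hs sI).
have s0 : 0 <= s by move: sI; rewrite /= in_itv/= => /andP[].
have ly : (Lr_norm 2%:E ((momentum rho v s - momentum rho v t)%R i) < +oo)%E.
  by apply: (@lty_poweRy _ _ 2); rewrite ?pnatr_eq0// (le_lt_trans hs) ?ltry.
rewrite (Lr_norm2_Rint ly) lee_fin in hs.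
have [_ L2] := Lr_norm2_L2on ly.
have := sqr_Rintegral_le measurable_cell leb2_cell L2.
move=> /le_trans/(_ hs); rewrite [X in X ^+ 2](_ : _ = M s - M t); last first.
  by rewrite /M /torus_int -RintegralB//; [exact: measurable_cell|
    exact: momentum_integrable|exact: momentum_integrable].
move=> h2; rewrite distrC -(@ler_pXn2r _ 2) ?nnegrE ?(ltW e0)//.
by rewrite real_normK ?num_real.
Qed.

Lemma momentum_conserved t : 0 <= t -> M t = M 0.
Proof.
have cM s : 0 < s -> {for s, continuous M}.
  move=> s0; have T0 : 0 < s + 1 by rewrite ltr_wpDl// ltW.
  (* As [s] is interior to [0, s + 1], continuity relative to this interval is continuity at [s]. *)
  have h : M r @[r --> within `[0, s + 1] (nbhs s)] --> M s.
    by apply: momentum_cont => //; rewrite (ltW s0) lerDl ler01.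
  apply/cvgrPdist_le => e e0; have /cvgrPdist_le /(_ _ e0) := h.
  rewrite near_withinE => h'; near=> r; apply: (near h' r) => //.
  rewrite /= in_itv/=; apply/andP; split; apply: ltW.
    by near: r; exact: lt_nbhsr.
  by near: r; apply: lt_nbhsl; rewrite ltrDl.
have cst_pos := const_of_test cM.
have {}cst_pos : forall t1 t2, 0 < t1 -> t1 < t2 -> M t1 = M t2.
  apply: cst_pos => s T psi s0 sT cpsi psi0.
  case: hreg => _ _ /(_ i)[rA _] _ _.
  have := st_int_wD_dt s0 sT cpsi psi0 rA.
  rewrite (momentum_weak_eq0 s0 sT cpsi psi0) oppr0.
  rewrite (st_int_test s0 sT (Cinf_derive1 cpsi) (derive1_eq0_off_support psi0))//.
    exact: (regular_loc_integrable rA).1.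
  move=> r /andP[sr _]; apply: momentum_integrable.
  exact: ltW (lt_le_trans s0 sr).
rewrite le_eqVlt => /predU1P[<-//|t0].
have h : M s @[s --> within `[0, t] (nbhs 0)] --> M 0.
  by apply: momentum_cont => //; rewrite lexx ltW.
apply/eqP; rewrite -subr_eq0 -normr_le0; apply/ler_addgt0Pl => e e0; rewrite addr0.
have /cvgrPdist_le /(_ _ e0) := h; rewrite near_withinE => /nbhs_ballP[d /= d0 hd].
(* A positive time close enough to 0 for continuity there, and smaller than [t] so that constancy on
   positive times applies. *)
pose r := Num.min (d / 2) (t / 2).
have r0 : 0 < r by rewrite lt_min !divr_gt0.
have rt : r < t by rewrite gt_min; apply/orP; right; lra.
rewrite distrC -(cst_pos _ _ r0 rt); apply: hd.
  rewrite /ball/= sub0r normrN gtr0_norm// gt_min; apply/orP; left; lra.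
by rewrite /= in_itv/= !ltW.
Unshelve. all: by end_near. Qed.

End momentum_conservation.

(** * Convergence of the velocity *)

Section continuous_functions_on_the_plane.
Context {R : realType}.
Notation mR := (measurableTypeR R).

(** An open set is a countable union of boxes with rational centres and half-sides; this links the
    topology of the plane to its product sigma-algebra. *)
Lemma open_measurable_plane (U : set (R * R)) : open U -> measurable (U : set (mR * mR)).
Proof.
move=> oU.
pose box (p q r : rat) : set (mR * mR) := let p' := ratr p : R in let q' := ratr q in
  let r' := ratr r in `]p' - r', p' + r'[ `*` `]q' - r', q' + r'[.
pose B p q r := if `[< box p q r `<=` U >] then box p q r else set0.
have -> : U = \bigcup_p \bigcup_q \bigcup_r B p q r.
  apply/seteqP; split=> [[x y] Uxy|z [p _ [q _ [r _]]]]; last first.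
    by rewrite /B; case: asboolP => // h /h.
  have [e /= e0 he] : exists2 e : R, 0 < e & ball (x, y) e `<=` U.
    by have /nbhs_ballP[e e0 he] := open_nbhs_nbhs (conj oU Uxy); exists e.
  have e4 : 0 < e / 4 by rewrite divr_gt0.
  (* With a centre closer than e / 4, a half-side above e / 4 captures the point, and one below e /
     2 keeps the box within 3 e / 4 of it. *)
  have [r re] : exists r : rat, e / 4 < ratr r < e / 2.
    have [|r] := @rat_in_itvoo R (e / 4) (e / 2); first by lra.
    by rewrite in_itv/=; exists r.
  have close (u : R) : exists p : rat, `|u - ratr p| < e / 4.
    have [|p] := @rat_in_itvoo R (u - e / 4) (u + e / 4); first by lra.
    by rewrite in_itv/= => /andP[? ?]; exists p; rewrite ltr_norml; apply/andP; split; lra.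
  have [p] := close x; have [q] := close y.
  rewrite !ltr_norml => /andP[q1 q2] /andP[p1 p2].
  move: re => /andP[r1 r2].
  exists p => //; exists q => //; exists r => //.
  rewrite /B asboolT.
    by split; rewrite /= in_itv/=; apply/andP; split; lra.
  move=> [x' y'] [/=]; rewrite !in_itv/= => /andP[? ?] /andP[? ?]; apply: he.
  by split; rewrite /ball/= ltr_norml; apply/andP; split; lra.
apply: bigcupT_measurable_rat => p; apply: bigcupT_measurable_rat => q.
apply: bigcupT_measurable_rat => r; rewrite /B; case: asboolP => // _.
by apply: measurableX; exact: measurable_itv.
Qed.

Lemma continuous_measurable_plane (f : R * R -> R) : continuous f ->
  measurable_fun setT (f : mR * mR -> R).
Proof.
move=> cf; apply: (measurability _ (RGenOInfty.measurableE R)) => _ [_ [c ->] <-].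
rewrite setTI; apply: open_measurable_plane.
by move/continuousP : cf; apply; exact: interval_open.
Qed.

Lemma continuous_bounded_cell (f : R * R -> R) : continuous f ->
  exists M, forall z, cell z -> `|f z| <= M.
Proof.
move=> cf.
have cK : compact (`[0%R, 1%R]%classic `*` `[0%R, 1%R]%classic : set (R * R)).
  by apply: compact_setX; exact: segment_compact.
have cn : {within (`[0%R, 1%R]%classic `*` `[0%R, 1%R]%classic : set (R * R)),
    continuous (fun z => `|f z|)}.
  apply: continuous_subspaceT => z.
  by apply: continuous_comp; [exact: cf|exact: norm_continuous].
have [|c _ hc] := compact_EVT_max _ cK cn.
  by exists (0, 0); split; rewrite /= in_itv/= lexx ler01.
exists `|f c| => -[x y] [/=]; rewrite !in_itv/= => /andP[x0 x1] /andP[y0 y1].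
apply: hc; rewrite inE; split; rewrite /= in_itv/=; [rewrite x0|rewrite y0]; exact: ltW.
Qed.

Lemma continuous_integrable_cell (f : R * R -> R) : continuous f ->
  (leb2 R).-integrable cell (EFin \o f).
Proof.
move=> cf; have [M hM] := continuous_bounded_cell cf.
have muCy : (leb2 R cell < +oo)%E by rewrite leb2_cell ltry.
apply: (integrable_bounded measurable_cell muCy _ hM).
by apply: measurable_funTS; exact: continuous_measurable_plane.
Qed.

Lemma integral_derive_unit (F F' : R -> R) : continuous F' ->
  (forall x, is_derive x (1 : R) F (F' x)) -> F 1 = F 0 ->
  (\int[leb1 R]_(x in `[0%R, 1%R[) (F' x)%:E = 0)%E.
Proof.
move=> cF' dF F10.
have cF : continuous F.
  by move=> x; apply/differentiable_continuous/derivable1_diffP; case: (dF x).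
rewrite integral_itv_bndo_bndc; last first.
  by apply/measurable_EFinP/measurable_funTS; exact: continuous_measurable_fun.
rewrite (@continuous_FTC2 _ _ F)//.
- by rewrite F10 -EFinB subrr.
- exact: continuous_subspaceT.
- split=> [x _||].
  + by case: (dF x).
  + by apply: cvg_at_right_filter; exact: cF.
  + by apply: cvg_at_left_filter; exact: cF.
- by move=> x _; rewrite derive1E; exact: derive_val.
Qed.

Lemma smooth_section1 (phi : R * R -> R) y x : smooth phi ->
  is_derive x (1 : R) (fun x => phi (x, y)) ('D_(1, 0) phi (x, y)).
Proof.
move=> sphi; have d : derivable phi (x, y) (1, 0) by apply/diff_derivable; exact: (sphi [::]).
have e : (fun h : R => h^-1 *: (((fun x => phi (x, y)) \o shift x) (h *: (1 : R)) - phi (x, y))) =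
    (fun h : R => h^-1 *: ((phi \o shift (x, y)) (h *: ((1, 0) : R * R)) - phi (x, y))).
  apply/funext => h; congr (_ *: (phi _ - _)).
  by rewrite /shift/= -[y in LHS]add0r -[0 in LHS](scaler0 _ h).
by apply: DeriveDef; rewrite /derivable /derive e.
Qed.

Lemma smooth_section2 (phi : R * R -> R) x y : smooth phi ->
  is_derive y (1 : R) (fun y => phi (x, y)) ('D_(0, 1) phi (x, y)).
Proof.
move=> sphi; have d : derivable phi (x, y) (0, 1) by apply/diff_derivable; exact: (sphi [::]).
have e : (fun h : R => h^-1 *: (((fun y => phi (x, y)) \o shift y) (h *: (1 : R)) - phi (x, y))) =
    (fun h : R => h^-1 *: ((phi \o shift (x, y)) (h *: ((0, 1) : R * R)) - phi (x, y))).
  apply/funext => h; congr (_ *: (phi _ - _)).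
  by rewrite /shift/= -[x in LHS]add0r -[0 in LHS](scaler0 _ h).
by apply: DeriveDef; rewrite /derivable /derive e.
Qed.

(** Along each horizontal line the values at the two ends of the period cancel. Hence constants have
    zero weak first derivatives. *)
Lemma torus_int_derive1 (phi : R * R -> R) : smooth phi -> torus_periodic phi ->
  torus_int ('D_(1, 0) phi) = 0.
Proof.
move=> sphi pphi; have cD := smooth_continuous (@smooth_derive _ _ _ ((1, 0) : R * R) sphi).
rewrite /torus_int /Rintegral (integral_cell2 (continuous_integrable_cell cD)).
rewrite integral0_eq// => y _.
apply: (@integral_derive_unit (fun x => phi (x, y)) (fun x => 'D_(1, 0) phi (x, y))).
- move=> x; apply: (@continuous_comp _ _ _ (fun x : R => (x, y)) ('D_(1, 0) phi)); last exact: cD.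
  by apply: differentiable_continuous; exact: differentiable_pair.
- by move=> x; exact: smooth_section1.
- by have [<- _] := pphi 0 y; rewrite add0r.
Qed.

Lemma torus_int_derive2 (phi : R * R -> R) : smooth phi -> torus_periodic phi ->
  torus_int ('D_(0, 1) phi) = 0.
Proof.
move=> sphi pphi; have cD := smooth_continuous (@smooth_derive _ _ _ ((0, 1) : R * R) sphi).
rewrite /torus_int /Rintegral (integral_cell1 (continuous_integrable_cell cD)).
rewrite integral0_eq// => x _.
apply: (@integral_derive_unit (fun y => phi (x, y)) (fun y => 'D_(0, 1) phi (x, y))).
- move=> y; apply: (@continuous_comp _ _ _ (fun y : R => (x, y)) ('D_(0, 1) phi)); last exact: cD.
  by apply: differentiable_continuous; exact: differentiable_pair.
- by move=> y; exact: smooth_section2.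
- by have [_ <-] := pphi x 0; rewrite add0r.
Qed.

End continuous_functions_on_the_plane.

(** * Weak derivatives: subtraction of constants and order zero *)

Section weak_derivatives.
Context {R : realType}.
Notation mR := (measurableTypeR R).
Implicit Types (f g : R * R -> R) (c : R).

Let mC : measurable (@cell R : set (mR * mR)) := measurable_cell.
Let muCy : (leb2 R cell < +oo)%E. Proof. by rewrite leb2_cell ltry. Qed.

Definition order1 (al : nat * nat) := al = (1%N, 0%N) \/ al = (0%N, 1%N).

Lemma weak_partial_subr al f g c : order1 al ->
  weak_partial al f g -> weak_partial al (fun z => f z - c) g.
Proof.
move=> al1 [fi gi fg]; split => //.
  by apply: (integrable_EFinB mC fi); exact: (integrable_EFin_cst mC).
move=> phi sphi pphi; rewrite -fg//.
have sD : smooth (iter_derive (multi_dirs R al) phi).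
  by case: al1 => ->; exact: smooth_derive.
have D0 : torus_int (iter_derive (multi_dirs R al) phi) = 0.
  by case: al1 => ->; [exact: torus_int_derive1|exact: torus_int_derive2].
set D := iter_derive _ _ in sD D0 *.
have cD := smooth_continuous sD.
have iD := continuous_integrable_cell cD.
have [M hM] := continuous_bounded_cell cD.
have mD := integrable_EFin_measurable iD.
rewrite /torus_int in D0 *.
transitivity (\int[leb2 R]_(z in cell) (f z * D z - c * D z)).
  by apply: eq_Rintegral => z _; rewrite mulrBl.
rewrite RintegralB//; last 2 first.
- exact: (integrable_EFinM mC fi mD hM).
- exact: integrable_EFinZ.
by rewrite RintegralZl// D0 mulr0 subr0.
Qed.

Lemma partial_norm_subr (r : \bar R) al f c : order1 al ->
  partial_norm r al (fun z => f z - c) = partial_norm r al f.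
Proof.
move=> al1; rewrite /partial_norm.
(* The two predicates are equal, so the choice inside [partial_norm] selects the same representative
   for both functions. *)
have e : weak_partial al (fun z => f z - c) = weak_partial al f.
  apply/funext => g; apply/propext; split; last exact: weak_partial_subr.
  move=> /(weak_partial_subr (- c) al1).
  by rewrite (_ : (fun z => f z - c - - c) = f)//; apply/funext => z; rewrite opprK subrK.
by rewrite e.
Qed.

Lemma partial_norm_lty (r : \bar R) al f : (partial_norm r al f < +oo)%E ->
  exists2 g, weak_partial al f g & partial_norm r al f = Lr_norm r g.
Proof.
rewrite /partial_norm; case: asboolP => // -[g fg] _.
exists (get [set g | weak_partial al f g]) => //.
exact: (getPex (P := [set g | weak_partial al f g]) (ex_intro _ g fg)).
Qed.

(** At order zero the definition says that [g - f] is orthogonal to all test functions. The lemma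
    compares [f] with the representative picked by choice in its order-zero norm. *)
Lemma weak_partial00 f g : weak_partial (0%N, 0%N) f g ->
  {ae leb2 R, forall z, cell z -> g z - f z = 0}.
Proof.
move=> [fi gi fg].
apply: cell_ae_eq0; first exact: (integrable_EFinB mC gi fi).
move=> a b [ca pa] [cb pb].
have st := smooth_tensor ca cb; have ct := smooth_continuous st.
have [M hM] := continuous_bounded_cell ct.
have mt := integrable_EFin_measurable (continuous_integrable_cell ct).
have := fg _ st (torus_periodic_tensor pa pb).
rewrite addn0 expr0 mul1r /iter_derive/= /torus_int => e.
transitivity (\int[leb2 R]_(z in cell) (g z * tensor a b z - f z * tensor a b z)).
  by apply: eq_Rintegral => z _; rewrite mulrBl.
by rewrite RintegralB ?e ?subrr//; [exact: (integrable_EFinM mC gi mt hM)|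
  exact: (integrable_EFinM mC fi mt hM)].
Qed.

Lemma partial_norm00E f : (leb2 R).-integrable cell (EFin \o f) ->
  (partial_norm 2%:E (0%N, 0%N) f `^ 2 = \int[leb2 R]_(z in cell) (f z ^+ 2)%:E)%E.
Proof.
move=> fi; have mf := integrable_EFin_measurable fi.
have ff : weak_partial (0%N, 0%N) f f.
  by split=> // phi _ _; rewrite addn0 expr0 mul1r.
rewrite /partial_norm asboolT; last by exists f.
set g := get _.
have fg : weak_partial (0%N, 0%N) f g by exact: (getPex (P := [set g | weak_partial (0%N, 0%N) f g]) (ex_intro _ f ff)).
have mg : measurable_fun cell g by case: fg => _ /integrable_EFin_measurable.
rewrite Lr_norm2E//; apply: ae_eq_integral => //.
- by apply/measurable_EFinP; exact: measurable_funX.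
- by apply/measurable_EFinP; exact: measurable_funX.
- have := weak_partial00 fg.
  apply: (@filterS _ _ (ae_filter_ringOfSetsType (leb2 R))) => z h /h/eqP.
  by rewrite subr_eq0 => /eqP ->.
Qed.

End weak_derivatives.

(** * From the conserved momentum to the mean velocity *)

Section mean_velocity.
Context {R : realType}.
Notation mR := (measurableTypeR R).
Implicit Types (f g p : R * R -> R).

Let mC : measurable (@cell R : set (mR * mR)) := measurable_cell.
Let muCy : (leb2 R cell < +oo)%E. Proof. by rewrite leb2_cell ltry. Qed.

Lemma L2on_mul f g : L2on (leb2 R) cell f -> L2on (leb2 R) cell g ->
  (leb2 R).-integrable cell (EFin \o (fun z => f z * g z)).
Proof.
move=> [mf f2] [mg g2].
apply: (le_integrable mC _ _ (integrable_EFinD mC f2 g2)).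
  by apply/measurable_EFinP; exact: measurable_funM.
move=> z _; rewrite lee_fin normrM [leRHS]ger0_norm ?addr_ge0 ?sqr_ge0//.
rewrite -(real_normK (num_real (f z))) -(real_normK (num_real (g z))).
have := sqr_ge0 (`|f z| - `|g z|); have := normr_ge0 (f z); have := normr_ge0 (g z).
nra.
Qed.

(** Young's inequality with weight [e], which balances a small [P] against a merely bounded [C]. *)
Lemma torus_int_mul_le (e P C : R) f g : 0 < e ->
  L2on (leb2 R) cell f -> L2on (leb2 R) cell g ->
  torus_int (fun z => f z ^+ 2) <= P -> torus_int (fun z => g z ^+ 2) <= C ->
  `|torus_int (fun z => f z * g z)| <= (P / e + e * C) / 2.
Proof.
move=> e0 L2f L2g fP gC; have ifg := L2on_mul L2f L2g.
apply: le_trans (le_normr_Rintegral mC ifg) _.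
case: (L2f) (L2g) => mf f2 [mg g2].
have i1 := integrable_EFinZ mC (2 * e)^-1 f2.
have i2 := integrable_EFinZ mC (e / 2) g2.
apply: (@le_trans _ _ (torus_int (fun z => (2 * e)^-1 * f z ^+ 2 + e / 2 * g z ^+ 2))).
  apply: le_Rintegral => //; [exact: integrable_norm|exact: integrable_EFinD|].
  move=> z _; rewrite normrM -(real_normK (num_real (f z))) -(real_normK (num_real (g z))).
  set x := `|f z|; set y := `|g z|.
  have -> : (2 * e)^-1 * x ^+ 2 + e / 2 * y ^+ 2 = x * y + (2 * e)^-1 * (x - e * y) ^+ 2.
    by field; rewrite gt_eqF.
  by rewrite lerDl mulr_ge0 ?sqr_ge0// invr_ge0 mulr_ge0// ltW.
rewrite /torus_int RintegralD// !RintegralZl//.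
have -> : (P / e + e * C) / 2 = (2 * e)^-1 * P + e / 2 * C by field; rewrite gt_eqF.
rewrite lerD// ler_wpM2l//; first by rewrite invr_ge0 mulr_ge0// ltW.
by rewrite divr_ge0// ltW.
Qed.

(* [m0 * (mean f - m / m0) = - \int p f] for [p = rho - m0], and [f - m / m0]
   splits as [(f - mean f) + (mean f - m / m0)]. *)
Lemma sqr_dist_mean_velocity (m0 m e P C D : R) r f : 0 < m0 -> 0 < e ->
  L2on (leb2 R) cell f -> L2on (leb2 R) cell (fun z => r z - m0) ->
  torus_int (fun z => r z * f z) = m ->
  torus_int (fun z => (r z - m0) ^+ 2) <= P -> torus_int (fun z => f z ^+ 2) <= C ->
  (\int[leb2 R]_(z in cell) ((f z - torus_int f) ^+ 2)%:E <= D%:E)%E ->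
  (\int[leb2 R]_(z in cell) ((f z - m0^-1 * m) ^+ 2)%:E <=
   (2 * D + 2 * ((P / e + e * C) / 2 / m0) ^+ 2)%:E)%E.
Proof.
move=> m00 e0 L2f L2r rfm rP fC hD.
have iF := L2on_integrable mC leb2_cell L2f.
have mf : measurable_fun cell f by case: L2f.
have ip := L2on_mul L2r L2f.
have rf : torus_int (fun z => (r z - m0) * f z) = m - m0 * torus_int f.
  have : torus_int (fun z => (r z - m0) * f z + m0 * f z) = m.
    by rewrite -rfm; apply: eq_Rintegral => z _; rewrite mulrBl subrK.
  rewrite {1}/torus_int RintegralD//; last exact: integrable_EFinZ.
  by rewrite RintegralZl// => <-; rewrite addrK.
set K := (P / e + e * C) / 2 / m0.
have dK : `|torus_int f - m0^-1 * m| <= K.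
  have -> : torus_int f - m0^-1 * m = - ((m - m0 * torus_int f) / m0).
    by field; rewrite gt_eqF.
  rewrite normrN normrM normfV (gtr0_norm m00) ler_pM2r ?invr_gt0// -rf.
  exact: torus_int_mul_le.
have K0 : 0 <= K by exact: le_trans (normr_ge0 _) dK.
have dK2 : (torus_int f - m0^-1 * m) ^+ 2 <= K ^+ 2.
  by rewrite -real_normK ?num_real// lerXn2r ?nnegrE.
have msq c : measurable_fun cell (fun z : mR * mR => ((f z - c) ^+ 2)%:E).
  by apply/measurable_EFinP; apply: measurable_funX; exact: measurable_funB.
apply: (@le_trans _ _ (\int[leb2 R]_(z in cell)
    (2%:E * ((f z - torus_int f) ^+ 2)%:E + (2 * K ^+ 2)%:E))%E).
  apply: ge0_le_integral => //.
  - by move=> z _; rewrite lee_fin sqr_ge0.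
  - exact: msq.
  - by apply: emeasurable_funD => //; apply: measurable_funeM; exact: msq.
  move=> z _; rewrite -EFinM -EFinD lee_fin.
  have -> : f z - m0^-1 * m = (f z - torus_int f) + (torus_int f - m0^-1 * m) by ring.
  set X := f z - _; set Y := torus_int f - _ in dK2 *.
  have := sqr_ge0 (X - Y); nra.
rewrite ge0_integralD//; last 3 first.
- by move=> z _; rewrite mule_ge0// lee_fin sqr_ge0.
- apply: measurable_funeM; exact: msq.
- by move=> z _; rewrite lee_fin mulr_ge0// sqr_ge0.
rewrite [leRHS]EFinD; apply: leeD.
  rewrite ge0_integralZl//; first by rewrite EFinM lee_wpmul2l.
    exact: msq.
  by move=> z _; rewrite lee_fin sqr_ge0.
apply: (@le_trans _ _ ((2 * K ^+ 2)%:E * leb2 R cell)%E).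
  by rewrite -(integral_cst (leb2 R) mC (2 * K ^+ 2)%:E).
by rewrite leb2_cell mule1.
Qed.

End mean_velocity.

Lemma le2D (R : realType) (x y : \bar R) (c d : R) : (x <= c%:E)%E -> (y <= d%:E)%E ->
  (2%:E * x + 2%:E * y <= (2 * c + 2 * d)%:E)%E.
Proof. by move=> xc yd; rewrite (EFinD (2 * c)) (EFinM 2 c) (EFinM 2 d) leeD// lee_wpmul2l. Qed.

Theorem theorem1p2 (R : realType) (mu a b beta gamma q : R)
  (hmu : 0 < mu) (ha : 0 < a) (hb : 0 < b)
  (hbeta : 4 / 3 < beta) (hgamma : 1 < gamma) (hq : 2 < q)
  (rho0 : R * R -> R) (v0 m0 : 'I_2 -> R * R -> R)
  (rho0_periodic : torus_periodic rho0) (v0_periodic : forall i, torus_periodic (v0 i))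
  (m0_periodic : forall i, torus_periodic (m0 i))
  (rho0_ge0 : torus_ae (fun x => 0 <= rho0 x))
  (rho0_W1q : (sobolev_norm 1 q rho0 < +oo)%E)
  (rho0_mean : 0 < mean rho0)
  (v0_H1 : (H1_norm v0 < +oo)%E)
  (m0E : forall i, torus_ae (fun x => m0 i x = rho0 x * v0 i x))
  (rho : R -> R * R -> R) (v : R -> 'I_2 -> R * R -> R)
  (hsol : global_strong_solution mu a b beta gamma q rho0 m0 rho v)
  (h1 : exists C : R, forall T : R, 0 < T ->
     (ereal_sup [set H1_norm (v t) | t in `[0%R, T]%classic] <= C%:E)%E)
  (h2 : forall p : R, 1 <= p ->
     (Lr_norm p%:E (fun x => rho t x - mean rho0)%R + grad_L2_norm (v t))%E
       @[t --> +oo] --> 0%E) :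
  let vs : 'I_2 -> R := fun i =>
    (mean rho0 * torus_area R)^-1 * torus_int (fun x => rho0 x * v0 i x) in
  H1_norm (fun i x => v t i x - vs i) @[t --> +oo] --> 0%E.
Proof.
move=> vs; have mC := measurable_cell (R := R).
have muCy : (leb2 R cell < +oo)%E by rewrite leb2_cell ltry.
have vsE i : vs i = (mean rho0)^-1 * torus_int (fun x => rho0 x * v0 i x).
  by rewrite /vs torus_area1 mulr1.
set r0 := mean rho0 in rho0_mean h2 vsE *.
case: h1 => C0 h1.
have [C [Cge0 hC]] : exists C : R, 0 <= C /\ forall t, 0 <= t ->
    forall i, (sobolev_norm 1 2 (v t i) `^ 2 <= C%:E)%E.
  (* The supremum up to T = t + 1 bounds the norm at the single time [t]; adding 1 makes T positive
     even at t = 0. *)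
  have hT t : 0 <= t -> (H1_norm (v t) <= C0%:E)%E.
    move=> t0; have t1 : 0 < t + 1 by rewrite ltr_wpDl.
    apply: le_trans (h1 _ t1); apply: ereal_sup_ubound; exists t => //.
    by rewrite /= in_itv/= t0 lerDl ler01.
  have C0ge0 : 0 <= C0.
    by rewrite -lee_fin; apply: le_trans (hT 0 (lexx _)); exact: poweR_ge0.
  exists (C0 ^+ 2); split=> [|t t0 i]; first exact: sqr_ge0.
  apply: le_trans (le_vect_norm2 _ _ i) _.
  by rewrite le_sqre_EFin//; [exact: hT|exact: poweR_ge0].
have pn_lty t i (al : 'I_2 * 'I_2) : 0 <= t -> (al.1 + al.2 <= 1)%N ->
    (partial_norm 2%:E (al.1 : nat, al.2 : nat) (v t i) < +oo)%E.
  move=> t0 al1; apply: (@lty_poweRy _ _ 2); first by rewrite pnatr_eq0.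
  apply: le_lt_trans (le_sobolev_norm12 _ al1) _.
  by apply: le_lt_trans (hC _ t0 i) _; rewrite ltry.
have iv t i : 0 <= t -> (leb2 R).-integrable cell (EFin \o v t i).
  move=> t0; have /(pn_lty _ i (ord0, ord0)) := t0.
  by move=> /(_ isT)/partial_norm_lty[g []].
have v2 t i : 0 <= t -> L2on (leb2 R) cell (v t i) /\ torus_int (fun z => v t i z ^+ 2) <= C.
  move=> t0; have ivt := iv _ i t0; have mv := integrable_EFin_measurable ivt.
  have le2 : (\int[leb2 R]_(z in cell) (v t i z ^+ 2)%:E <= C%:E)%E.
    rewrite -(partial_norm00E ivt); apply: le_trans (hC _ t0 i).
    exact: (@le_sobolev_norm12 _ _ (ord0, ord0)).
  have i2 : (leb2 R).-integrable cell (EFin \o (fun z => v t i z ^+ 2)).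
    apply/integrableP; split; first by apply/measurable_EFinP; exact: measurable_funX.
    under eq_integral do rewrite gee0_abs ?lee_fin ?sqr_ge0//.
    by apply: le_lt_trans le2 _; rewrite ltry.
  split; first by [].
  rewrite -lee_fin /torus_int fineK//; exact: (integrable_fin_num mC i2).
have hcont T : 0 < T -> cont_in_time T (vect_norm 2 (Lr_norm 2%:E)) (momentum rho v).
  by move=> T0; case: (gss_regularity hsol T0) => _ _ _ _ [].
have rhov t i : 0 <= t ->
    torus_int (fun z => rho t z * v t i z) = torus_int (fun x => rho0 x * v0 i x).
  move=> t0; transitivity (torus_int (momentum rho v t i)); first by [].
  rewrite (momentum_conserved (gss_derivatives hsol) (gss_momentum hsol) hcont i t0).
  rewrite /torus_int /Rintegral; congr fine; apply: ae_eq_integral => //.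
  - have := momentum_integrable hcont i (lexx 0); exact: measurable_int.
  (* Measurability of [rho0 * v0] is extracted from the finiteness of the Sobolev norms of the two
     factors. *)
  - have q0 : 0 < q by rewrite (lt_trans _ hq).
    have [g [ir _ _]] := sobolev_norm_exists q0 rho0_W1q.
    have v0lty : (sobolev_norm 1 2 (v0 i) < +oo)%E.
      apply: (@lty_poweRy _ _ 2); first by rewrite pnatr_eq0.
      exact: le_lt_trans (le_vect_norm2 _ _ i) (poweR_lty _ v0_H1).
    have [g' [iv0 _ _]] := sobolev_norm_exists (ltr0n R 2) v0lty.
    apply/measurable_EFinP; apply: measurable_funM.
      exact: integrable_EFin_measurable ir.
    exact: integrable_EFin_measurable iv0.
  - have := m0E i; have := gss_init_mom hsol i.
    apply: (@filterS2 _ _ (ae_filter_ringOfSetsType (leb2 R))) => z e1 e2 Cz.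
    by rewrite e1// e2.
have H0 t : (0 <= H1_norm (fun i x => v t i x - vs i)%R)%E by exact: poweR_ge0.
apply: (ge0_cvge0_sqr _ H0).2 => e e0.
(* Two components, each with squared norm at most 4 e', give exactly e. *)
pose e' := e / 8.
have e'0 : 0 < e' by rewrite divr_gt0.
(* [k] will bound |mean v - vs|. Its choice gives 2 k^2 = e' / 2, which leaves e' / 2 for the
   oscillation of the velocity. *)
pose k := Num.sqrt e' / 2.
have k0 : 0 < k by rewrite divr_gt0// sqrtr_gt0.
have k2 : k ^+ 2 = e' / 4 by rewrite /k exprMn sqr_sqrtr ?ltW//; field.
(* The weight in Young's inequality: eta C <= k r0, and P = k r0 eta gives P / eta = k r0, so that
   (P / eta + eta C) / 2 / r0 <= k. The 1 in C + 1 keeps the denominator positive. *)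
pose eta := k * r0 / (C + 1).
have C1 : 0 < C + 1 by rewrite ltr_wpDl.
have eta0 : 0 < eta by rewrite divr_gt0// mulr_gt0.
(* The first entry bounds each squared partial derivative, which the Poincare inequality turns into
   2 (e' / 16) + 2 (e' / 16) = e' / 4; the second bounds the squared density deviation. *)
pose d := Num.min (e' / 16) (k * r0 * eta).
have kr0 : 0 < k * r0 * eta by apply: mulr_gt0 eta0; exact: mulr_gt0.
have d0 : 0 < d by rewrite lt_min kr0 andbT divr_gt0.
have lim2 := h2 2 ltac:(by rewrite ler1n).
have Lg0 t : (0 <= Lr_norm 2%:E (fun x => rho t x - r0)%R + grad_L2_norm (v t))%E.
  by rewrite adde_ge0 ?Lr_norm_ge0 ?poweR_ge0.
near=> t.
have t0 : 0 <= t by near: t; exact: nbhs_pinfty_ge.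
have hLg : ((Lr_norm 2%:E (fun x => rho t x - r0)%R + grad_L2_norm (v t)) `^ 2 <= d%:E)%E.
  by near: t; exact: (ge0_cvge0_sqr _ Lg0).1 lim2 _ d0.
have hL : (Lr_norm 2%:E (fun x => rho t x - r0)%R `^ 2 <= d%:E)%E.
  apply: le_trans hLg; apply: le_sqre; first exact: Lr_norm_ge0.
  by rewrite leeDl// poweR_ge0.
have hg : (grad_L2_norm (v t) `^ 2 <= d%:E)%E.
  apply: le_trans hLg; apply: le_sqre; first exact: poweR_ge0.
  by rewrite leeDr// Lr_norm_ge0.
have Llty : (Lr_norm 2%:E (fun x => rho t x - r0)%R < +oo)%E.
  by apply: (@lty_poweRy _ _ 2); rewrite ?pnatr_eq0// (le_lt_trans hL) ?ltry.
have [_ L2r] := Lr_norm2_L2on Llty.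
have rP : torus_int (fun z => (rho t z - r0) ^+ 2) <= k * r0 * eta.
  rewrite -lee_fin /torus_int -(Lr_norm2_Rint Llty); apply: le_trans hL _.
  by rewrite lee_fin ge_min lexx orbT.
have hpn i : (partial_norm 2%:E (1%N, 0%N) (v t i) `^ 2 <= (e' / 16)%:E)%E /\
    (partial_norm 2%:E (0%N, 1%N) (v t i) `^ 2 <= (e' / 16)%:E)%E.
  have : (partial_norm 2%:E (1%N, 0%N) (v t i) `^ 2 +
      partial_norm 2%:E (0%N, 1%N) (v t i) `^ 2 <= (e' / 16)%:E)%E.
    apply: (@le_trans _ _ d%:E); last by rewrite lee_fin ge_min lexx.
    apply: le_trans hg; rewrite grad_L2_norm2E (bigD1 i)//= leeDl// sume_ge0// => j _.
    by rewrite adde_ge0 ?poweR_ge0.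
  move=> h; split; apply: le_trans h.
    by rewrite leeDl// poweR_ge0.
  by rewrite leeDr// poweR_ge0.
have hsob i : (sobolev_norm 1 2 (fun x => v t i x - vs i)%R `^ 2 <= (4 * e')%:E)%E.
  have [p10 p01] := hpn i.
  have e16 : e' / 16 <= e' by lra.
  (* Order at most one leaves (0, 0), (0, 1) and (1, 0). In the last two the constant [vs i]
     disappears; only the first uses the Poincare inequality and momentum conservation. *)
  apply: sobolev_norm12_le => [|[[|[|j]] [|[|l]]] //= _]; first exact: ltW.
  - rewrite partial_norm00E; last first.
      by apply: (integrable_EFinB mC (iv _ i t0)); exact: (integrable_EFin_cst mC).
    have [L2v vC] := v2 _ i t0.
    have l10 : (partial_norm 2%:E (1%N, 0%N) (v t i) < +oo)%E.
      exact: (pn_lty _ i (lift ord0 ord0, ord0) t0 isT).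
    have l01 : (partial_norm 2%:E (0%N, 1%N) (v t i) < +oo)%E.
      exact: (pn_lty _ i (ord0, lift ord0 ord0) t0 isT).
    have [g1 w1 n1] := partial_norm_lty l10.
    have [g2 w2 n2] := partial_norm_lty l01.
    have m1 : measurable_fun cell g1 by case: w1 => _ /integrable_EFin_measurable.
    have m2 : measurable_fun cell g2 by case: w2 => _ /integrable_EFin_measurable.
    have hP := poincare w1 w2.
    rewrite -(Lr_norm2E m1) -(Lr_norm2E m2) -n1 -n2 in hP.
    have {}hP : (\int[leb2 R]_(z in cell) ((v t i z - torus_int (v t i)) ^+ 2)%:E <=
        (e' / 4)%:E)%E.
      apply: le_trans hP _; have -> : e' / 4 = 2 * (e' / 16) + 2 * (e' / 16) by field.
      exact: (le2D p10 p01).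
    have := sqr_dist_mean_velocity rho0_mean eta0 L2v L2r (rhov _ i t0) rP vC hP.
    rewrite -vsE => /le_trans; apply; rewrite lee_fin.
    have K0 : 0 <= (k * r0 * eta / eta + eta * C) / 2 / r0.
      apply: divr_ge0; last exact: ltW.
      apply: divr_ge0 => //; apply: addr_ge0; last exact: mulr_ge0 (ltW eta0) Cge0.
      by apply: divr_ge0; apply: ltW.
    have Kk : (k * r0 * eta / eta + eta * C) / 2 / r0 <= k.
      rewrite mulfK ?gt_eqF// ler_pdivrMr// ler_pdivrMr//.
      have : eta * C <= k * r0.
        rewrite /eta mulrAC ler_pdivrMr// ler_wpM2l ?lerDl//.
        by apply/ltW/mulr_gt0.
      by move=> ?; lra.
    have : ((k * r0 * eta / eta + eta * C) / 2 / r0) ^+ 2 <= k ^+ 2.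
      by rewrite lerXn2r ?nnegrE// ltW.
    by rewrite k2; lra.
  - rewrite partial_norm_subr; last by right.
    by apply: le_trans p01 _; rewrite lee_fin.
  - rewrite partial_norm_subr; last by left.
    by apply: le_trans p10 _; rewrite lee_fin.
rewrite /H1_norm vect_norm2E; apply: (@le_trans _ _ (\sum_(i < 2) (4 * e')%:E)%E).
  by apply: lee_sum => i _; exact: hsob.
rewrite sumEFin sumr_const card_ord lee_fin /e' -mulr_natl; lra.
Unshelve. all: by end_near. Qed.
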